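(* Let $T>0$, $\xi\in\mathbb{R}^d$, $F\in C^3_b(\mathbb{R}^d,\mathcal{L}(\mathbb{R}^n,\mathbb{R}^d))$, and let $\mathbf{W}=(W,\mathbb{W})$ be a $\beta$-Hölder rough path on $[0,T]$ with $W$ taking values in $\mathbb{R}^n$ and $\beta\in(1/3,1/2)$. There is a unique modelled distribution $\underline{Y}\in D^{2\beta}_{M^r}(\mathbb{R}^d)$ such that for all $t\in[0,T]$, $$\underline{Y}(t)=\xi\,\underline{1}+L(\hat F(\underline{Y}))(t).$$
   Context: For a path $Z$ write $Z_{s,t}:=Z_t-Z_s$. $C^3_b$ is the set of $C^3$ functions which are bounded together with their derivatives up to order $3$. A $\beta$-Hölder rough path is a pair $(W,\mathbb{W})$, $W:[0,T]\to\mathbb{R}^n$, $\mathbb{W}:[0,T]^2\to\mathbb{R}^n\otimes\mathbb{R}^n$, with $\mathbb{W}_{s,t}-\mathbb{W}_{s,u}-\mathbb{W}_{u,t}=W_{s,u}\otimes W_{u,t}$ for all $s,u,t$, $\sup_{s\neq t}\|W_{s,t}\|/|t-s|^\beta<\infty$ and $\sup_{s\neq t}\|\mathbb{W}_{s,t}\|/|t-s|^{2\beta}<\infty$. Modelled distributions. Let $\underline{1}$ be an abstract symbol of homogeneity $0$ and $\underline{W}=(\underline{W}^1,\dots,\underline{W}^n)$ abstract symbols of homogeneity $\beta$. For a finite-dimensional normed space $E$, consider formal expressions $a\underline{1}+b\underline{W}$ with $a\in E$, $b\in\mathcal{L}(\mathbb{R}^n,E)$, where $b\,\underline{W}=\sum_i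 b(e_i)\underline{W}^i$; put $\|a\underline{1}+b\underline{W}\|_0=\|a\|$, $\|a\underline{1}+b\underline{W}\|_\beta=\|b\|$. For $s,t\in[0,T]$ let $\Gamma_{t,s}(a\underline{1}+b\underline{W})=(a+bW_{s,t})\underline{1}+b\underline{W}$. $D^{2\beta}_{M^r}(E)$ is the space of functions $\underline{Y}(t)=y_t\underline{1}+y'_t\underline{W}$, $t\in[0,T]$, with $$\sup_{s\neq t\in[0,T]}\ \sup_{\epsilon\in\{0,\beta\}}\frac{\|\underline{Y}(t)-\Gamma_{t,s}\underline{Y}(s)\|_\epsilon}{|t-s|^{2\beta-\epsilon}}<\infty.$$ Composition. For $\underline{Y}(t)=y_t\underline{1}+y'_t\underline{W}$ in $D^{2\beta}_{M^r}(\mathbb{R}^d)$, $\hat F(\underline{Y})(t):=F(y_t)\underline{1}+F'(y_t)y'_t\underline{W}$, where $F'(y_t)y'_t\in\mathcal{L}(\mathbb{R}^n,\mathcal{L}(\mathbb{R}^n,\mathbb{R}^d))$ is $v\mapsto F'(y_t)(y'_tv)$; this belongs to $D^{2\beta}_{M^r}(\mathcal{L}(\mathbb{R}^n,\mathbb{R}^d))$. Integration map. For $\underline{Z}(t)=z_t\underline{1}+z'_t\underline{W}$ in $D^{2\beta}_{M^r}(\mathcal{L}(\mathbb{R}^n,\mathbb{R}^d))$, $L(\underline{Z})(t):=\left(\int_0^tz_u\,\mathrm{d}\mathbf{W}_u\right)\underline{1}+z_t\,\underline{W}$, where $\int_0^tz_u\,\mathrm{d}\mathbf{W}_u:=\lim_{|\mathcal{P}|\to0}\sum_{u,v\in\mathcal{P}}\left(z_uW_{u,v}+z'_u\mathbb{W}_{u,v}\right)$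 is the rough integral, the limit being over subdivisions $\mathcal{P}$ of $[0,t]$ with mesh $|\mathcal{P}|\to0$ and the sum over successive points $u,v$ of $\mathcal{P}$ (the limit exists), with $z'_u\mathbb{W}_{u,v}:=\sum_{i,j=1}^n(z'_ue_i)(e_j)\mathbb{W}^{i,j}_{u,v}$. $L$ maps $D^{2\beta}_{M^r}(\mathcal{L}(\mathbb{R}^n,\mathbb{R}^d))$ into $D^{2\beta}_{M^r}(\mathbb{R}^d)$. *)

(* Defs.v *)
From HB Require Import structures.
From mathcomp Require Import all_boot all_order all_algebra.
From mathcomp Require Import all_classical all_reals all_analysis.

Set Implicit Arguments.
Unset Strict Implicit.
Unset Printing Implicit Defensive.

Import Order.TTheory GRing.Theory Num.Theory.
Import numFieldNormedType.Exports.

Local Open Scope classical_set_scope.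
Local Open Scope ring_scope.

(** Conventions: R^d is ['cV[R]_d] and L(R^n, R^d) is ['M[R]_(d, n)], both with
    the max norm of the library; R^n (x) R^n is ['M[R]_n], u (x) v being the
    matrix with entries u_i v_j.  A normed space [E] of values is a matrix
    space, which covers both R^d and L(R^n, R^d).  Paths are functions on [R]
    of which only the values on [0, T] are ever used. *)

(** [iter_diff f [:: v1; ..; vk] x] is D^k f(x)[v1, .., vk]. *)
Fixpoint iter_diff (R : realType) (V E : normedModType R) (f : V -> E)
    (vs : seq V) : V -> E :=
  if vs is v :: vs' then fun x => 'd (iter_diff f vs') x v else f.

(** The class C^k_b.  Between finite-dimensional spaces, differentiability and
    continuity of the multilinear-map-valued function D^j f amount to those of
    all its evaluations.  The bound is on the norm of D^j f(x) as a multilinear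
    map, uniformly in x. *)
Record Cb (R : realType) (V E : normedModType R) (k : nat) (f : V -> E) : Prop :=
  { Cb_differentiable : forall vs : seq V, (size vs < k)%N ->
      forall x, differentiable (iter_diff f vs) x;
    Cb_continuous : forall vs : seq V, size vs = k ->
      continuous (iter_diff f vs);
    Cb_bounded : forall j : nat, (j <= k)%N ->
      exists C : R, forall (x : V) (vs : seq V), size vs = j ->
        `|iter_diff f vs x| <= C * \prod_(v <- vs) `|v| }.

Definition incr (R : realType) (V : zmodType) (Z : R -> V) (s t : R) : V :=
  Z t - Z s.

Record rough_path (R : realType) (n : nat) (beta T : R)
    (W : R -> 'cV[R]_n) (WW : R -> R -> 'M[R]_n) : Prop :=
  { rough_path_chen : forall s u t : R,
      s \in `[0, T] -> u \in `[0, T] -> t \in `[0, T] ->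
      WW s t - WW s u - WW u t = incr W s u *m (incr W u t)^T;
    rough_path_holder1 : exists C : R, forall s t : R,
      s \in `[0, T] -> t \in `[0, T] -> s != t ->
      `|incr W s t| / `|t - s| `^ beta <= C;
    rough_path_holder2 : exists C : R, forall s t : R,
      s \in `[0, T] -> t \in `[0, T] -> s != t ->
      `|WW s t| / `|t - s| `^ (2 * beta) <= C }.

Definition opnorm (R : realType) (n p q : nat)
    (b : 'Hom('cV[R]_n, 'M[R]_(p, q))) : R :=
  sup [set `|b v| | v in [set v : 'cV[R]_n | `|v| <= 1]].

(** The pair [(a, b)] is the formal expression a 1 + b W, where 1 and W stand
    for the two abstract symbols. *)
Notation expr R n p q :=
  ('M[R]_(p, q) * 'Hom('cV[R]_n, 'M[R]_(p, q)))%type (only parsing).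

(** The norms of the components of homogeneity 0 and beta. *)
Definition expr_norm0 (R : realType) (n p q : nat) (e : expr R n p q) : R :=
  `|e.1|.
Definition expr_normbeta (R : realType) (n p q : nat) (e : expr R n p q) : R :=
  opnorm e.2.

(** Gamma_{t,s}; note the order of the indices. *)
Definition Gamma (R : realType) (n p q : nat) (W : R -> 'cV[R]_n) (t s : R)
    (e : expr R n p q) : expr R n p q :=
  (e.1 + e.2 (incr W s t), e.2).

(** Membership in D^{2 beta}. *)
Definition modelled (R : realType) (n p q : nat) (beta T : R)
    (W : R -> 'cV[R]_n) (Y : R -> expr R n p q) : Prop :=
  exists C : R, forall s t : R,
    s \in `[0, T] -> t \in `[0, T] -> s != t ->
    expr_norm0 (Y t - Gamma W t s (Y s)) / `|t - s| `^ (2 * beta) <= C /\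
    expr_normbeta (Y t - Gamma W t s (Y s)) / `|t - s| `^ (2 * beta - beta) <= C.

Definition Fhat (R : realType) (d n : nat) (F : 'cV[R]_d -> 'M[R]_(d, n))
    (Y : R -> expr R n d 1) (t : R) : expr R n d n :=
  let y := (Y t).1 in (F y, (linfun ('d F y) \o (Y t).2)%VF).

(** A subdivision 0 = t_0 < t_1 < .. < t_k = t is represented by
    [s := [:: t_1; ..; t_k]] with [itv_partition 0 t s]; [zip (0 :: s) s] lists
    the pairs of its successive points. *)
Definition mesh (R : realType) (s : seq R) : R :=
  \big[Num.max/0]_(uv <- zip (0 :: s) s) (uv.2 - uv.1).

Definition mesh_to0 (R : realType) (t : R) : set_system (seq R) :=
  [set A | exists2 delta : R, 0 < delta &
    forall s : seq R, itv_partition 0 t s -> mesh s < delta -> A s].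

Definition contract2 (R : realType) (d n : nat)
    (b : 'Hom('cV[R]_n, 'M[R]_(d, n))) (A : 'M[R]_n) : 'cV[R]_d :=
  \sum_(i < n) \sum_(j < n) A i j *: (b (delta_mx i 0) *m delta_mx j 0).

Definition rough_sum (R : realType) (d n : nat) (W : R -> 'cV[R]_n)
    (WW : R -> R -> 'M[R]_n) (Z : R -> expr R n d n) (s : seq R) : 'cV[R]_d :=
  \sum_(uv <- zip (0 :: s) s)
    ((Z uv.1).1 *m incr W uv.1 uv.2 + contract2 (Z uv.1).2 (WW uv.1 uv.2)).

(** The integral from 0 to [t]; like any [lim] it is unspecified when the limit
    does not exist, which never occurs for Z in D^{2 beta} when beta > 1/3. *)
Definition rough_integral (R : realType) (d n : nat) (W : R -> 'cV[R]_n)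
    (WW : R -> R -> 'M[R]_n) (Z : R -> expr R n d n) (t : R) : 'cV[R]_d :=
  lim (rough_sum W WW Z @ mesh_to0 t).

Definition integration_map (R : realType) (d n : nat) (W : R -> 'cV[R]_n)
    (WW : R -> R -> 'M[R]_n) (Z : R -> expr R n d n) (t : R) : expr R n d 1 :=
  (rough_integral W WW Z t, linfun (mulmx (Z t).1)).

(* Main.v *)
Require Import Defs.
From HB Require Import structures.
From mathcomp Require Import all_boot all_order all_algebra.
From mathcomp Require Import all_classical all_reals all_analysis.
From mathcomp Require Import ring lra zify.

Set Implicit Arguments.
Unset Strict Implicit.
Unset Printing Implicit Defensive.

Import Order.TTheory GRing.Theory Num.Theory.
Import numFieldNormedType.Exports.

Local Open Scope classical_set_scope.
Local Open Scope ring_scope.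

(** The coefficient of the first-order symbol in a fixed point must be
    y' = F(y), so the equation is one on the path y alone: with z = F(y) and
    z' = F'(y)F(y), y_t = xi + int_0^t z dW.  This amounts to Davie's local
    expansion
      y_t = mu_{s,t}(y_s) + O(|t - s|^{3 beta}),   y_0 = xi,
      mu_{s,t}(x) = x + F(x) W_{s,t} + F'(x)F(x) WW_{s,t},
    because 3 beta > 1: errors of that order, summed over a subdivision, vanish
    with the mesh ([riemann_sum_cvg]).  Chen's relation and F in C^3_b make mu
    an almost flow ([davie_almost_flow]): mu_{u,t} o mu_{s,u} - mu_{s,t} is of
    order |t - s|^{3 beta} in sup norm and in Lipschitz seminorm, and
    mu_{s,t} - id is of order |t - s|^beta with two derivatives, derivatives
    being replaced throughout by finite differences.

    Two facts hold for every almost flow with exponent > 1.  Trajectories (paths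
    satisfying the local expansion) exist from every point: Euler schemes on
    uniform grids satisfy the expansion with a constant independent of the
    grid, and a pointwise limit along an ultrafilter inherits it
    ([trajectory_exists]).  Trajectories are determined by their initial value:
    on a short interval where two of them start together, a bound on their
    distance improves by a factor 1/2 ([trajectory_unique]).  Both rest on one
    sewing inequality ([sewing_bound]).

    The existence statement is used twice.  Applied to mu it gives the solution.
    Applied to the almost flow x |-> x + z_s W_{s,t} + z'_s WW_{s,t}, which
    translates by an amount independent of x ([controlled_almost_flow]), it
    shows that the rough integral converges and satisfies its local expansion,
    so that every fixed point is a trajectory of mu; uniqueness follows. *)

(** * Identities in abelian groups *)

(** Identities between signed sums in an arbitrary abelian group are decided by
    comparing, for every atom, its integer coefficients on both sides. *)
Inductive gexp := GAtom of nat | GZero | GAdd of gexp & gexp | GOpp of gexp.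

Fixpoint geval (V : zmodType) (atoms : seq V) (e : gexp) : V :=
  match e with
  | GAtom i => nth 0 atoms i
  | GZero => 0
  | GAdd a b => geval atoms a + geval atoms b
  | GOpp a => - geval atoms a
  end.

Fixpoint gcoef (e : gexp) (i : nat) : int :=
  match e with
  | GAtom j => if i == j then 1 else 0
  | GZero => 0
  | GAdd a b => gcoef a i + gcoef b i
  | GOpp a => - gcoef a i
  end.

Lemma gevalE (V : zmodType) (atoms : seq V) (e : gexp) :
  geval atoms e = \sum_(i < size atoms) nth 0 atoms i *~ gcoef e i.
Proof.
elim: e => [j||a IHa b IHb|a IH] /=.
- case: (ltnP j (size atoms)) => js.
    rewrite (bigD1 (Ordinal js)) //= eqxx mulr1z big1 ?addr0// => i.
    by rewrite -val_eqE /= => /negbTE ->; rewrite mulr0z.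
  rewrite nth_default// big1// => i _; case: eqP => [ij|_];
    last by rewrite mulr0z.
  by move: (ltn_ord i); rewrite ij ltnNge js.
- by rewrite big1// => i _; rewrite mulr0z.
- by rewrite IHa IHb -big_split; apply: eq_bigr => i _ /=; rewrite mulrzDr.
- by rewrite IH -sumrN; apply: eq_bigr => i _ /=; rewrite mulrNz.
Qed.

Lemma geval_eq (V : zmodType) (atoms : seq V) (a b : gexp) :
  all (fun i => gcoef a i == gcoef b i) (iota 0 (size atoms)) ->
  geval atoms a = geval atoms b.
Proof.
move=> /allP ab; rewrite !gevalE; apply: eq_bigr => i _.
by rewrite (eqP (ab i _))// mem_iota ltn_ord.
Qed.

Ltac gindex x l :=
  lazymatch l with
  | x :: _ => constr:(0%N)
  | _ :: ?l' => let i := gindex x l' in constr:(i.+1)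
  end.
Ltac gmember x l :=
  lazymatch l with
  | x :: _ => constr:(true)
  | _ :: ?l' => gmember x l'
  | _ => constr:(false)
  end.
Ltac gatoms e l :=
  lazymatch e with
  | ?a + ?b => let l' := gatoms a l in gatoms b l'
  | - ?a => gatoms a l
  | 0 => l
  | _ => lazymatch gmember e l with true => l | false => constr:(e :: l) end
  end.
Ltac greify e l :=
  lazymatch e with
  | ?a + ?b => let a' := greify a l in let b' := greify b l in
      constr:(GAdd a' b')
  | - ?a => let a' := greify a l in constr:(GOpp a')
  | 0 => constr:(GZero)
  | _ => let i := gindex e l in constr:(GAtom i)
  end.
Ltac abel :=
  lazymatch goal with |- @eq ?T ?x ?y =>
    let l := gatoms x (@nil T) in let l := gatoms y l in
    let a := greify x l in let b := greify y l in
    exact: (@geval_eq _ l a b isT)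
  end.

(** * The sewing inequality *)

Lemma ler_geometric_limit (R : realType) (k x y z : R) :
  0 <= k < 1 -> (forall m : nat, x <= k ^+ m * y + z) -> x <= z.
Proof.
move=> /andP[k0 k1] H.
have lim0 : (fun m => k ^+ m * y + z) @ \oo --> 0 * y + z.
  apply: cvgD; last exact: cvg_cst.
  by apply: cvgMl; apply: cvg_expr; rewrite ger0_norm.
rewrite -[leRHS](_ : 0 * y + z = z); last by rewrite mul0r add0r.
by apply: (cvgr_to_ge lim0); apply: nearW => m; exact: H.
Qed.

Lemma powR_subr1 (R : realType) (theta x : R) :
  1 < theta -> 0 <= x -> x `^ theta = x `^ (theta - 1) * x.
Proof.
move=> th1 x0; rewrite -[X in _ * X]powRr1// -powRD ?subrK//.
by apply/implyP => /eqP e; move: th1; rewrite e ltr10.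
Qed.

(** Where theta > 1 enters: the factor on the right is < 1, so cutting an
    interval into two pieces that are not too unequal gains on h^theta. *)
Lemma powR_split (R : realType) (theta h1 h2 h : R) :
  1 < theta -> 0 <= h1 -> 0 <= h2 -> h1 + h2 = h ->
  h1 <= 2 / 3 * h -> h2 <= 2 / 3 * h ->
  h1 `^ theta + h2 `^ theta <= (2 / 3) `^ (theta - 1) * h `^ theta.
Proof.
move=> th1 h10 h20 h12 h1h h2h.
have h0 : 0 <= h by rewrite -h12 addr_ge0.
have le1 x : 0 <= x -> x <= 2 / 3 * h ->
    x `^ theta <= (2 / 3) `^ (theta - 1) * h `^ (theta - 1) * x.
  move=> x0 xh; rewrite (powR_subr1 th1)// ler_wpM2r// -powRM//.
  by rewrite ge0_ler_powR ?nnegrE//; lra.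
by rewrite (le_trans (lerD (le1 _ h10 h1h) (le1 _ h20 h2h)))// -mulrDr h12
  (powR_subr1 th1 h0)// mulrA.
Qed.

(** The fixed point 1 / (1 - k) of the iteration in [sewing_bound] when B = 1,
    times the largest value of the weight of [sewing_step]. *)
Definition sewing_const (R : realType) (T beta theta M : R) : R :=
  expR (M / (1 - (2 / 3) `^ beta) * T `^ beta) / (1 - (2 / 3) `^ (theta - 1)).

Lemma powR_lt1 (R : realType) (p : R) : 0 < p -> 0 <= (2 / 3 : R) `^ p < 1.
Proof.
move=> p0; have e1 : (1 : R) `^ p = 1 by rewrite powR1.
rewrite powR_ge0/= -[ltRHS]e1.
by rewrite gt0_ltr_powR ?nnegrE//; lra.
Qed.

Lemma sewing_const_ge0 (R : realType) (T beta theta M : R) :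
  1 < theta -> 0 <= sewing_const T beta theta M.
Proof.
move=> th1; have /andP[_ k1] := @powR_lt1 R (theta - 1) ltac:(lra).
by rewrite divr_ge0 ?expR_ge0//; lra.
Qed.

(** The weight exp(c h^beta) absorbs the factor 1 + M h^beta on intervals of any
    length: c is chosen so that M + c (2/3)^beta = c, and both pieces have
    length at most 2h/3. *)
Lemma sewing_step (R : realType) (beta theta M a B h1 h2 h : R) :
  0 < beta -> 1 < theta -> 0 <= M -> 0 <= a -> 0 <= B ->
  0 <= h1 -> 0 <= h2 -> h1 + h2 = h -> h1 <= 2 / 3 * h -> h2 <= 2 / 3 * h ->
  forall k c, k = (2 / 3) `^ (theta - 1) -> c = M / (1 - (2 / 3) `^ beta) ->
  a * expR (c * h2 `^ beta) * h2 `^ theta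
  + (1 + M * h `^ beta) * (a * expR (c * h1 `^ beta) * h1 `^ theta)
  + B * h `^ theta
  <= (k * a + B) * expR (c * h `^ beta) * h `^ theta.
Proof.
move=> b0 th1 M0 a0 B0 h10 h20 h12 h1h h2h k c k_def c_def.
have h0 : 0 <= h by rewrite -h12 addr_ge0.
have hb : 0 <= h `^ beta by exact: powR_ge0.
have hsum := powR_split th1 h10 h20 h12 h1h h2h.
have /andP[] := powR_lt1 b0; move: c_def; set q :=
  (_ / _) `^ beta => c_def q0 q1.
have c0 : 0 <= c by rewrite c_def divr_ge0// subr_ge0 ltW.
have cM : M + c * q = c by rewrite c_def; field; rewrite subr_eq0 eq_sym lt_eqF.
have e1 : 1 <= expR (c * h `^ beta).
  by rewrite -expR0 ler_expR mulr_ge0.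
have ele x : 0 <= x -> x <= 2 / 3 * h ->
    expR (c * x `^ beta) <= expR (c * q * h `^ beta).
  move=> x0 xh; rewrite ler_expR -mulrA ler_wpM2l// -powRM//.
  by rewrite ge0_ler_powR ?nnegrE// ?mulr_ge0// ltW.
have M1 : 1 + M * h `^ beta <= expR (M * h `^ beta) by exact: expR_ge1Dx.
have M1' : 0 <= 1 + M * h `^ beta by rewrite addr_ge0// mulr_ge0.
have esplit : expR (c * h `^ beta) =
    expR (M * h `^ beta) * expR (c * q * h `^ beta).
  by rewrite -expRD -mulrDl cM.
have le2 : a * expR (c * h2 `^ beta) * h2 `^ theta
    <= a * expR (c * h `^ beta) * h2 `^ theta.
  apply: ler_wpM2r; [exact: powR_ge0|apply: ler_wpM2l => //].
  apply: (le_trans (ele _ h20 h2h)).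
  by rewrite ler_expR ler_wpM2r// -[leRHS]cM lerDr.
have le1 : (1 + M * h `^ beta) * (a * expR (c * h1 `^ beta) * h1 `^ theta)
    <= a * expR (c * h `^ beta) * h1 `^ theta.
  rewrite mulrA ler_wpM2r ?powR_ge0// mulrCA ler_wpM2l// esplit.
  by apply: ler_pM; [exact: M1'|exact: expR_ge0|exact: M1|exact: ele].
rewrite [in leRHS]mulrDl [in leRHS]mulrDl; apply: lerD; last first.
  by apply: ler_wpM2r; [exact: powR_ge0|exact: ler_peMr].
apply: le_trans (lerD le2 le1) _.
rewrite -mulrDr addrC.
have -> : k * a * expR (c * h `^ beta) * h `^ theta =
  a * expR (c * h `^ beta) * (k * h `^ theta) by ring.
by apply: ler_wpM2l; [apply: mulr_ge0 => //; exact: expR_ge0|rewrite k_def].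
Qed.

(** By [sewing_step] a bound of psi with constant a improves to one with
    constant k a + B, where k < 1; iterating from any a priori bound brings it
    to the fixed point B / (1 - k), whatever the a priori constant was.

    The index type I is the real line in the uniqueness argument and the set of
    grid indices for Euler schemes, where psi vanishes on neighbours. *)
Lemma sewing_bound (R : realType) (I : Type) (pos : I -> R)
    (S : I -> I -> Prop) (psi : I -> I -> R) (T beta theta M B : R) :
  0 < beta -> 1 < theta -> 0 <= M -> 0 <= B ->
  (forall s t, S s t -> 0 <= pos t - pos s <= T) ->
  (exists a, forall s t, S s t -> psi s t <= a * (pos t - pos s) `^ theta) ->
  (forall s t, S s t -> psi s t <= 0 \/
     exists u, [/\ S s u, S u t, pos u - pos s <= 2 / 3 * (pos t - pos s),
       pos t - pos u <= 2 / 3 * (pos t - pos s) &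
       psi s t <= psi u t + (1 + M * (pos t - pos s) `^ beta) * psi s u
                  + B * (pos t - pos s) `^ theta]) ->
  forall s t, S s t ->
    psi s t <= sewing_const T beta theta M * B * (pos t - pos s) `^ theta.
Proof.
move=> b0 th1 M0 B0 ST [a apriori] split.
set k := (2 / 3 : R) `^ (theta - 1); set q := (2 / 3 : R) `^ beta.
have k01 : 0 <= k < 1 by apply: powR_lt1; rewrite subr_gt0.
have /andP[q0 q1] : 0 <= q < 1 by apply: powR_lt1.
have [k0 k1] := andP k01.
set c := M / (1 - q).
have c0 : 0 <= c by rewrite divr_ge0// subr_ge0 ltW.
pose bd a' := forall s t, S s t -> psi s t <=
  a' * expR (c * (pos t - pos s) `^ beta) * (pos t - pos s) `^ theta.
have bdS a' : 0 <= a' -> bd a' -> bd (k * a' + B).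
  move=> a'0 bda s t Sst; have /andP[h0 hT] := ST _ _ Sst.
  have [psi0|[u [Ssu Sut us tu psile]]] := split _ _ Sst.
    apply: (le_trans psi0); rewrite !mulr_ge0 ?powR_ge0 ?expR_ge0//.
    by rewrite addr_ge0// mulr_ge0.
  have /andP[h10 _] := ST _ _ Ssu; have /andP[h20 _] := ST _ _ Sut.
  apply: (le_trans psile).
  apply: le_trans (sewing_step b0 th1 M0 a'0 B0 h10 h20 _ us tu (erefl k)
    (erefl c)); last first.
    by rewrite addrC subrKA.
  apply: lerD => //; apply: lerD; first exact: bda.
  by rewrite ler_wpM2l// ?bda// addr_ge0// mulr_ge0// powR_ge0.
have bd0 : bd `|a|.
  move=> s t Sst; have /andP[h0 hT] := ST _ _ Sst.
  apply: (le_trans (apriori _ _ Sst)); rewrite ler_wpM2r ?powR_ge0//.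
  apply: (le_trans (ler_norm a)); rewrite ler_peMr//.
  by rewrite -expR0 ler_expR mulr_ge0// powR_ge0.
have B1 : 0 <= B / (1 - k) by rewrite divr_ge0// subr_ge0 ltW.
have bdn m : bd (k ^+ m * `|a| + B / (1 - k)).
  elim: m => [|m IH].
    move=> s t Sst; apply: (le_trans (bd0 _ _ Sst)).
    by rewrite !ler_wpM2r ?powR_ge0 ?expR_ge0// expr0 mul1r lerDl.
  have -> : k ^+ m.+1 * `|a| + B / (1 - k) =
      k * (k ^+ m * `|a| + B / (1 - k)) + B
    by rewrite exprS; field; rewrite subr_eq0 eq_sym lt_eqF.
  by apply: bdS => //; rewrite addr_ge0// mulr_ge0// exprn_ge0.
move=> s t Sst; have /andP[h0 hT] := ST _ _ Sst.
set h := pos t - pos s in h0 hT *.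
have : psi s t <= B / (1 - k) * expR (c * h `^ beta) * h `^ theta.
  apply: (@ler_geometric_limit _ k _
    (`|a| * expR (c * h `^ beta) * h `^ theta)) => // m.
  by have := bdn m _ _ Sst; rewrite -/h !mulrDl !mulrA.
move=> /le_trans; apply; rewrite ler_wpM2r ?powR_ge0//.
rewrite /sewing_const -/k -/q -/c.
have -> : expR (c * T `^ beta) / (1 - k) * B =
  B / (1 - k) * expR (c * T `^ beta).
  by ring.
apply: ler_wpM2l => //; rewrite ler_expR; apply: ler_wpM2l => //.
by apply: ge0_ler_powR => //; rewrite ?nnegrE ?(le_trans h0 hT)// ltW.
Qed.

(** * Almost flows and the uniqueness of their trajectories *)

Record lip1 (R : realType) (V W : normedModType R) (c : R) (f : V -> W) :
    Prop :=
  { lip1_bound : forall x, `|f x| <= c;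
    lip1_lip : forall x y, `|f x - f y| <= c * `|x - y| }.

Lemma lip1_le (R : realType) (V W : normedModType R) (c c' : R) (f : V -> W) :
  c <= c' -> lip1 c f -> lip1 c' f.
Proof.
move=> cc' [f0 f1]; split=> [x|x y]; first exact: le_trans cc'.
by apply: (le_trans (f1 x y)); exact: ler_wpM2r.
Qed.

(** The class C^{1,1}_b, stated with finite differences: it then passes to sums
    and products without any differentiation of composites. *)
Record lip2 (R : realType) (V W : normedModType R) (c : R) (f : V -> W) :
    Prop :=
  { lip2_bound : forall x, `|f x| <= c;
    lip2_lip : forall x y, `|f x - f y| <= c * `|x - y|;
    lip2_diff2 : forall x a b,
      `|f (x + a + b) - f (x + a) - f (x + b) + f x| <= c * `|a| * `|b| }.

Lemma lip2_ge0 (R : realType) (V W : normedModType R) (c : R) (f : V -> W) :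
  lip2 c f -> 0 <= c.
Proof. by move=> /lip2_bound/(_ 0); apply: le_trans. Qed.

(** The two pairs (x + a, y + b) and (x, y) are compared through y + a, where
    the second difference applies. *)
Lemma lip2_four (R : realType) (V W : normedModType R) (c : R) (f : V -> W)
    (x y a b : V) :
  lip2 c f ->
  `|f (x + a) - f (y + b) - (f x - f y)| <= c * `|x - y| * `|a| + c * `|a - b|.
Proof.
move=> lf; have l1 := lip2_diff2 lf y (x - y) a.
have l2 := lip2_lip lf (y + a) (y + b).
rewrite (_ : y + (x - y) = x) in l1; last by abel.
have -> : f (x + a) - f (y + b) - (f x - f y) =
    (f (x + a) - f x - f (y + a) + f y) + (f (y + a) - f (y + b)) by abel.
apply: le_trans (ler_normD _ _) _; apply: lerD => //.
by apply: (le_trans l2); rewrite (_ : y + a - (y + b) = a - b)//; abel.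
Qed.

(** Continuity in time, the last field, lets an expansion known at grid points
    pass to arbitrary times. *)
Record almost_flow (R : realType) (V : normedModType R) (T beta theta M : R)
    (mu : R -> R -> V -> V) : Prop :=
  { almost_flow_near : forall s t : R, 0 <= s -> s <= t -> t <= T ->
      lip2 (M * (t - s) `^ beta) (fun x => mu s t x - x);
    almost_flow_comp : forall s u t : R, 0 <= s -> s <= u -> u <= t -> t <= T ->
      lip1 (M * (t - s) `^ theta) (fun x => mu u t (mu s u x) - mu s t x);
    almost_flow_time : forall (s t s' t' : R) x,
      0 <= s -> s <= t -> t <= T -> 0 <= s' -> s' <= t' -> t' <= T ->
      `|mu s t x - mu s' t' x| <= M * (`|s - s'| `^ beta + `|t - t'| `^ beta) }.

Definition trajectory (R : realType) (V : normedModType R) (T theta : R)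
    (mu : R -> R -> V -> V) (y : R -> V) : Prop :=
  exists C : R, forall s t : R, 0 <= s -> s <= t -> t <= T ->
    `|y t - mu s t (y s)| <= C * (t - s) `^ theta.

Lemma midf_two_thirds (R : realType) (s t : R) : s <= t ->
  (s + t) / 2 - s <= 2 / 3 * (t - s) /\ t - (s + t) / 2 <= 2 / 3 * (t - s).
Proof. by move=> st; split; lra. Qed.

Section AlmostFlow.
Variables (R : realType) (V : normedModType R) (T beta theta M : R).
Variable mu : R -> R -> V -> V.
Hypotheses (T0 : 0 < T) (beta0 : 0 < beta) (theta1 : 1 < theta) (M0 : 0 <= M).
Hypothesis muF : almost_flow T beta theta M mu.

Let theta0 : 0 <= theta. Proof. exact: ltW (lt_trans ltr01 theta1). Qed.

Lemma almost_flow_lip (s t : R) x y : 0 <= s -> s <= t -> t <= T ->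
  `|mu s t x - mu s t y| <= (1 + M * (t - s) `^ beta) * `|x - y|.
Proof.
move=> s0 st tT; have l := lip2_lip (almost_flow_near muF s0 st tT) x y.
have -> : mu s t x - mu s t y = (x - y) + ((mu s t x - x) - (mu s t y - y)).
  by abel.
by rewrite mulrDl mul1r (le_trans (ler_normD _ _))// lerD.
Qed.

Lemma almost_flow_id (s : R) x : 0 <= s -> s <= T -> mu s s x = x.
Proof.
move=> s0 sT; have := lip2_bound (almost_flow_near muF s0 (lexx s) sT) x.
by rewrite subrr powR0 ?gt_eqF// mulr0 normr_le0 subr_eq0 => /eqP.
Qed.

(** The sewing inequality is applied to
      psi s t = |(y_t - z_t) - (mu_{s,t} y_s - mu_{s,t} z_s)|.
    Through an intermediate time u, this splits into psi u t, the effect of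
    mu_{u,t} on the four points y_u, z_u, mu_{s,u} y_s, mu_{s,u} z_s, and the
    difference of the composition defects at y_s and z_s; the last two are
    linear in the distance of y and z, which is what makes the bound
    homogeneous in E. *)
Lemma trajectory_diff_bound y z : trajectory T theta mu y ->
  trajectory T theta mu z -> exists2 K : R, 0 <= K & forall p q E : R,
    0 <= p -> q <= T -> y p = z p ->
    (forall r : R, p <= r -> r <= q -> `|y r - z r| <= E) ->
    forall r : R, p <= r -> r <= q -> `|y r - z r| <= K * (r - p) `^ theta * E.
Proof.
move=> [Cy trajy] [Cz trajz].
pose L : R := M * T `^ beta; pose C : R := `|Cy| + `|Cz|.
have L0 : 0 <= L by rewrite mulr_ge0// powR_ge0.
have C0 : 0 <= C by rewrite addr_ge0.
have sewC0 := @sewing_const_ge0 R T beta theta M theta1.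
have D0 : 0 <= M + L * (1 + L) * C.
  by apply: addr_ge0 => //; apply: mulr_ge0 => //; apply: mulr_ge0 => //;
    apply: addr_ge0.
exists (sewing_const T beta theta M * (M + L * (1 + L) * C)).
  exact: mulr_ge0.
move=> p q E p0 qT ypzp eE r pr rq.
have E0 : 0 <= E by apply: le_trans (eE _ (lexx p) (le_trans pr rq)).
have traj_le (w : R -> V) (Cw : R) : `|Cw| <= C ->
    (forall s t : R, 0 <= s -> s <= t -> t <= T ->
      `|w t - mu s t (w s)| <= Cw * (t - s) `^ theta) ->
    forall s t : R, 0 <= s -> s <= t -> t <= T ->
    `|w t - mu s t (w s)| <= C * (t - s) `^ theta.
  move=> CwC H s t s0 st tT; apply: (le_trans (H _ _ s0 st tT)).
  by apply: ler_wpM2r; [exact: powR_ge0|exact: le_trans (ler_norm _) CwC].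
have CyC : `|Cy| <= C by rewrite lerDl.
have CzC : `|Cz| <= C by rewrite lerDr.
have {trajy}trajy := traj_le _ _ CyC trajy.
have {trajz}trajz := traj_le _ _ CzC trajz.
pose psi s t := `|(y t - z t) - (mu s t (y s) - mu s t (z s))|.
have psir : `|y r - z r| = psi p r by rewrite /psi ypzp subrr subr0.
rewrite psir -mulrA (mulrC _ E) mulrA -(mulrA _ (M + _)).
apply: (@sewing_bound R R id (fun s t => [/\ p <= s, s <= t & t <= q]) psi
  T beta theta M) => //.
- exact: mulr_ge0.
- move=> s t [ps st tq] /=; rewrite subr_ge0 st/= lerBlDr.
  by rewrite (le_trans (le_trans tq qT))// lerDl (le_trans p0).
- exists (C + C) => s t [ps st tq] /=.
  have s0 := le_trans p0 ps; have tT := le_trans tq qT.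
  rewrite mulrDl /psi.
  rewrite (_ : _ - _ = (y t - mu s t (y s)) - (z t - mu s t (z s)));
    last by abel.
  apply: le_trans (ler_normB _ _) _; apply: lerD; [exact: trajy|exact: trajz].
move=> s t [ps st tq] /=; right; exists ((s + t) / 2).
have su : s <= (s + t) / 2 by rewrite midf_le.
have ut : (s + t) / 2 <= t by rewrite midf_le.
have h0 : 0 <= t - s by rewrite subr_ge0.
have [us tu] := midf_two_thirds st.
move: ((s + t) / 2) su ut us tu => u su ut us tu.
have s0 := le_trans p0 ps; have tT := le_trans tq qT.
have u0 := le_trans s0 su; have uT := le_trans ut tT.
split=> //; [by split=> //; exact: le_trans tq|by split=> //;
  exact: le_trans su|].
have hpow : forall e x : R, 0 <= e -> 0 <= x -> x <= t - s ->
  x `^ e <= (t - s) `^ e.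
  by move=> e x e0 x0 xh; rewrite ge0_ler_powR ?nnegrE.
have hpowT : (t - s) `^ beta <= T `^ beta.
  rewrite ge0_ler_powR ?nnegrE//; [exact: ltW|exact: ltW|].
  by rewrite lerBlDr (le_trans tT)// lerDl.
have us_h : u - s <= t - s by rewrite lerD2r.
have ut_h : t - u <= t - s by rewrite lerD2l lerN2.
have us0 : 0 <= u - s by rewrite subr_ge0.
have tu0 : 0 <= t - u by rewrite subr_ge0.
set h := t - s in h0 us tu hpow hpowT us_h ut_h *.
have es : `|y s - z s| <= E by apply: eE => //; exact: le_trans tq.
pose P := mu s u (y s); pose Q := mu s u (z s).
pose a x := mu u t x - x.
have PQ : `|P - Q| <= (1 + L) * E.
  apply: (le_trans (almost_flow_lip _ _ s0 su uT)); apply: ler_pM => //.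
    by rewrite addr_ge0// mulr_ge0// powR_ge0.
  rewrite lerD2l; apply: ler_wpM2l => //; apply: le_trans hpowT.
  by apply: hpow => //; exact: ltW.
have near := almost_flow_near muF u0 ut tT.
have four := lip2_four P Q (y u - P) (z u - Q) near.
rewrite /= (_ : P + (y u - P) = y u) in four; last by abel.
rewrite (_ : Q + (z u - Q) = z u) in four; last by abel.
have yP : `|y u - P| <= C * h `^ theta.
  apply: le_trans (trajy _ _ s0 su uT) _; apply: ler_wpM2l => //.
  exact: hpow.
have psisu : `|y u - P - (z u - Q)| = psi s u.
  by rewrite /psi -/P -/Q; congr `| _ |; abel.
rewrite psisu in four.
have -> : psi s t = `|((y t - z t) - (mu u t (y u) - mu u t (z u)))
    + ((y u - P) - (z u - Q) + (mu u t (y u) - y u - (mu u t (z u) - z u) -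
       (mu u t P - P - (mu u t Q - Q))))
    + ((mu u t P - mu s t (y s)) - (mu u t Q - mu s t (z s)))|.
  by rewrite /psi; congr `| _ |; abel.
rewrite -addrA; apply: le_trans (ler_normD _ _) _.
rewrite -[leRHS]addrA; apply: lerD; first exact: lexx.
apply: le_trans (ler_normD _ _) _.
have Mh : M * (t - u) `^ beta <= M * h `^ beta.
  by apply: ler_wpM2l => //; apply: hpow => //; exact: ltW.
have Mh0 : 0 <= M * (t - u) `^ beta by rewrite mulr_ge0// powR_ge0.
have ML : M * h `^ beta <= L by apply: ler_wpM2l.
have b1 : `|y u - P - (z u - Q) + (mu u t (y u) - y u - (mu u t (z u) - z u) -
     (mu u t P - P - (mu u t Q - Q)))| <=
    (1 + M * h `^ beta) * psi s u + L * (1 + L) * C * E * h `^ theta.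
  apply: le_trans (ler_normD _ _) _; rewrite psisu mulrDl mul1r -[leRHS]addrA.
  apply: lerD => //; apply: (le_trans four); rewrite [leRHS]addrC;
    apply: lerD; last first.
    by apply: ler_wpM2r; [exact: normr_ge0|].
  have -> : L * (1 + L) * C * E * h `^ theta =
    L * ((1 + L) * E) * (C * h `^ theta) by ring.
  apply: ler_pM => //; first by rewrite mulr_ge0.
  by apply: ler_pM => //; exact: le_trans ML.
have b2 : `|mu u t P - mu s t (y s) - (mu u t Q - mu s t (z s))| <=
    M * E * h `^ theta.
  apply: le_trans (lip1_lip (almost_flow_comp muF s0 su ut tT) _ _) _.
  rewrite mulrAC; apply: ler_wpM2r; first exact: powR_ge0.
  exact: ler_wpM2l.
apply: le_trans (lerD b1 b2) _; rewrite -addrA lerD2l.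
by rewrite le_eqVlt; apply/orP; left; apply/eqP; ring.
Qed.
End AlmostFlow.

Section TrajectoryUniqueness.
Variables (R : realType) (V : normedModType R) (T beta theta M : R).
Variable mu : R -> R -> V -> V.
Hypotheses (T0 : 0 < T) (beta0 : 0 < beta) (theta1 : 1 < theta) (M0 : 0 <= M).
Hypothesis muF : almost_flow T beta theta M mu.

(** On an interval of length tau, [trajectory_diff_bound] halves any bound E of
    the distance of two trajectories that start together, so they agree there;
    tau does not depend on the starting point, so finitely many such intervals
    cover [0, T]. *)
Lemma trajectory_unique y z : trajectory T theta mu y ->
  trajectory T theta mu z -> y 0 = z 0 ->
  forall t : R, 0 <= t -> t <= T -> y t = z t.
Proof.
move=> ty tz yz0.
have [K K0 diff] := trajectory_diff_bound T0 beta0 theta1 M0 muF ty tz.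
(* Since theta > 1 and tau <= 1, tau^theta <= tau, and K tau <= 1/2. *)
pose tau : R := (2 * K + 1)^-1.
have K1 : 1 <= 2 * K + 1 by rewrite lerDr mulr_ge0.
have tau0 : 0 < tau by rewrite invr_gt0 (lt_le_trans ltr01).
have tau1 : tau <= 1 by rewrite invf_le1// (lt_le_trans ltr01).
have small (h : R) : 0 <= h -> h <= tau -> K * h `^ theta <= 2^-1.
  move=> h0 ht; have hle : h `^ theta <= tau.
    apply: (@le_trans _ _ (tau `^ theta)).
      by apply: ge0_ler_powR; rewrite ?nnegrE ?(ltW tau0)// ltW//
        (lt_trans ltr01).
    by apply: ge1r_powR; [rewrite tau0 tau1|exact: ltW].
  apply: (le_trans (ler_wpM2l K0 hle)).
  by rewrite ler_pdivrMr ?(lt_le_trans ltr01)//; lra.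
have [Cy Hy] := ty; have [Cz Hz] := tz.
have local (p q : R) : 0 <= p -> p <= q -> q <= T -> q - p <= tau ->
    y p = z p -> y q = z q.
  move=> p0 pq qT qp ypzp.
  pose E0 : R := (`|Cy| + `|Cz|) * T `^ theta.
  have bound m : forall r : R, p <= r -> r <= q ->
      `|y r - z r| <= 2^-1 ^+ m * E0.
    elim: m => [|m IH] r pr rq.
      rewrite expr0 mul1r; have rT := le_trans rq qT.
      have -> : y r - z r = (y r - mu p r (y p)) - (z r - mu p r (z p)).
        by rewrite ypzp; abel.
      have hT : (r - p) `^ theta <= T `^ theta.
        apply: ge0_ler_powR; rewrite ?nnegrE ?subr_ge0 ?(ltW T0)//.
          exact: ltW (lt_trans ltr01 theta1).
        by rewrite lerBlDr (le_trans rT)// lerDl.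
      rewrite /E0 mulrDl; apply: le_trans (ler_normB _ _) _; apply: lerD.
        apply: (le_trans (Hy _ _ p0 pr rT)); apply: (le_trans (ler_norm _)).
        by rewrite normrM ler_pM// ger0_norm ?powR_ge0.
      apply: (le_trans (Hz _ _ p0 pr rT)); apply: (le_trans (ler_norm _)).
      by rewrite normrM ler_pM// ger0_norm ?powR_ge0.
    apply: (le_trans (diff p q _ p0 qT ypzp IH r pr rq)).
    rewrite exprS -[leRHS]mulrA; apply: ler_wpM2r.
      apply: mulr_ge0; first by rewrite exprn_ge0// invr_ge0.
      by apply: mulr_ge0; [rewrite addr_ge0|exact: powR_ge0].
    by apply: small; rewrite ?subr_ge0// (le_trans _ qp)// lerD2r.
  apply/eqP; rewrite -subr_eq0 -normr_le0.
  apply: (@ler_geometric_limit _ 2^-1 _ E0);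
    first by rewrite invr_ge0 invf_lt1; lra.
  by move=> m; rewrite addr0; exact: bound.
have steps (k : nat) : forall t : R, 0 <= t -> t <= T -> t <= k%:R * tau ->
  y t = z t.
  elim: k => [|k IH] t t0 tT tk.
    by have -> // : t = 0; apply/eqP; rewrite eq_le t0 andbT -[leRHS](mul0r
      tau).
  have [tk'|tk'] := leP t (k%:R * tau); first exact: IH.
  have ktau : 0 <= k%:R * tau by rewrite mulr_ge0// ltW.
  apply: (local (k%:R * tau) t) => //; first exact: ltW.
    by rewrite lerBlDl -[X in _ + X]mul1r -mulrDl natr1.
  by apply: IH => //; exact: le_trans (ltW tk') tT.
move=> t t0 tT; apply: (steps (Num.truncn (T / tau)).+1) => //.
rewrite -ler_pdivrMr// (le_trans _ (ltW (truncnS_gt _)))//.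
by rewrite ler_pM2r// invr_gt0.
Qed.

End TrajectoryUniqueness.

(** * Existence of trajectories *)

Lemma ler_mx_norm (R : realType) (p q : nat) (A : 'M[R]_(p, q)) i j :
  `|A i j| <= `|A|.
Proof.
by rewrite [leRHS]/Num.Def.normr/= mx_normrE; exact: (le_bigmax _ _ (i, j)).
Qed.

Lemma mx_norm_ler (R : realType) (p q : nat) (A : 'M[R]_(p, q)) (c : R) :
  0 <= c -> (forall i j, `|A i j| <= c) -> `|A| <= c.
Proof.
move=> c0 Ac; rewrite /Num.Def.normr/= mx_normrE; exact: bigmax_le.
Qed.

Lemma ultrafilter_bounded_limit (R : realType) (p q : nat) (U : set_system nat)
    (f : nat -> 'M[R]_(p, q)) (B : R) :
  UltraFilter U -> (forall m, `|f m| <= B) ->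
  exists l, forall e : R, 0 < e -> \forall m \near U, `|f m - l| <= e.
Proof.
move=> UU fB.
have entry (ij : 'I_p * 'I_q) : exists l : R,
    (fun m => f m ij.1 ij.2) @ U --> l.
  have := @segment_compact R (- B) B; rewrite compact_ultra => K.
  have UG : UltraFilter ((fun m => f m ij.1 ij.2) @ U).
    split=> [|G GF sub].
      exact: fmap_proper_filter.
    apply/seteqP; split=> // A GA; have [//|nA] :=
      in_ultra_setVsetC ((fun m => f m ij.1 ij.2) @^-1` A) UU.
    have : G (A `&` ~` A) by apply: filterI => //; exact: sub.
    by rewrite setICr => /filter_ex[].
  have [] := K _ UG.
    apply: (@filterE _ U) => m /=; rewrite in_itv/= -ler_norml.
    exact: le_trans (ler_mx_norm _ _ _) (fB m).
  by move=> l [_ cl]; exists l.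
have [l lP] := choice entry.
exists (\matrix_(i, j) l (i, j)) => e e0.
have : \forall m \near U, forall ij, `|f m ij.1 ij.2 - l ij| <= e.
  apply: filter_forall => ij; have /cvgrPdist_le /(_ _ e0) := lP ij.
  by apply: filterS => m; rewrite distrC.
apply: filterS => m mP; apply: mx_norm_ler => [|i j]; first exact: ltW.
by rewrite !mxE; exact: (mP (i, j)).
Qed.

Lemma nat_middle k l : (k.+1 < l)%N -> exists u,
  [/\ (k <= u)%N, (u <= l)%N, ((u - k) * 3 <= (l - k) * 2)%N
    & ((l - u) * 3 <= (l - k) * 2)%N].
Proof. by move=> kl; exists (k + (l - k)./2)%N; split; lia. Qed.

Lemma nat_two_thirds (R : realFieldType) (a b : nat) (h : R) :
  0 <= h -> (a * 3 <= b * 2)%N -> a%:R * h <= 2 / 3 * (b%:R * h).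
Proof.
move=> h0; rewrite -(ler_nat R) !natrM => ab; rewrite mulrA ler_wpM2r//; lra.
Qed.

Section TrajectoryExistence.
Variables (R : realType) (p q : nat) (T beta theta M : R).
Variable mu : R -> R -> 'M[R]_(p, q) -> 'M[R]_(p, q).
Hypotheses (T0 : 0 < T) (beta0 : 0 < beta) (theta1 : 1 < theta) (M0 : 0 <= M).
Hypothesis muF : almost_flow T beta theta M mu.

Let step (m : nat) : R := T / m.+1%:R.

Fixpoint euler (x : 'M[R]_(p, q)) (m i : nat) : 'M[R]_(p, q) :=
  if i is j.+1 then mu (j%:R * step m) (i%:R * step m) (euler x m j) else x.

Let step_gt0 m : 0 < step m. Proof. by rewrite divr_gt0. Qed.

Let grid_le (m i j : nat) : (i <= j)%N -> i%:R * step m <= j%:R * step m.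
Proof. by move=> ij; rewrite ler_pM2r// ler_nat. Qed.

Let grid_ge0 (m i : nat) : 0 <= i%:R * step m.
Proof. by rewrite mulr_ge0// ltW. Qed.

Let grid_leT (m i : nat) : (i <= m.+1)%N -> i%:R * step m <= T.
Proof.
by move=> im; rewrite mulrCA ler_piMr ?(ltW T0)// ler_pdivrMr// mul1r ler_nat.
Qed.

(** The Euler scheme satisfies the local expansion exactly between neighbouring
    grid points, so the sewing inequality propagates it to all pairs of grid
    points with a constant that does not depend on the grid. *)
Lemma euler_bound x m i j : (i <= j)%N -> (j <= m.+1)%N ->
  `|euler x m j - mu (i%:R * step m) (j%:R * step m) (euler x m i)|
    <= sewing_const T beta theta M * M * (j%:R * step m - i%:R * step m) `^
      theta.
Proof.
pose psi i j :=
  `|euler x m j - mu (i%:R * step m) (j%:R * step m) (euler x m i)|.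
have psige0 k l : 0 <= psi k l by exact: normr_ge0.
have psi0 k l : (k <= l <= m.+1)%N -> (l <= k.+1)%N -> psi k l = 0.
  move=> /andP[kl lm] lk; rewrite /psi.
  have [->|kl'] := eqVneq k l.
    by rewrite (almost_flow_id beta0 muF) ?subrr ?normr0 ?grid_leT.
  have -> : l = k.+1 by apply/eqP; rewrite eqn_leq lk ltn_neqAle kl' kl.
  by rewrite /= subrr normr0.
move=> ij jm; apply: (@sewing_bound R nat (fun k => k%:R * step m)
  (fun k l => (k <= l <= m.+1)%N) psi T beta theta M M) => //;
    last by rewrite ij jm.
- move=> k l /andP[kl lm]; rewrite subr_ge0 grid_le//= lerBlDr.
  by rewrite (le_trans (grid_leT lm))// lerDl.
(* Any bound will do here: the grid is finite, and distinct points are at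
   distance at least step m. *)
- exists ((\sum_(k < m.+2) \sum_(l < m.+2) psi k l) / step m `^ theta).
  move=> k l /andP[kl lm].
  have [klt|kge] := ltnP k l; last first.
    rewrite psi0 ?kl// ?(leq_trans kge)// mulr_ge0 ?powR_ge0// divr_ge0
      ?powR_ge0//.
    by apply: sumr_ge0 => k' _; apply: sumr_ge0 => l' _.
  have lm2 : (l < m.+2)%N by [].
  have km2 : (k < m.+2)%N by apply: leq_ltn_trans kl _.
  rewrite mulrAC ler_pdivlMr ?powR_gt0//; apply: ler_pM => //.
  + exact: powR_ge0.
  + rewrite (bigD1 (Ordinal km2))//=.
    rewrite (bigD1 (Ordinal lm2))//= -addrA lerDl addr_ge0//.
      by apply: sumr_ge0.
    by apply: sumr_ge0 => k' _; apply: sumr_ge0 => l' _.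
  + apply: ge0_ler_powR;
      rewrite ?nnegrE ?(ltW (step_gt0 _)) ?subr_ge0 ?grid_le//.
      exact: ltW (lt_trans ltr01 theta1).
    rewrite -mulrBl ler_peMl ?(ltW (step_gt0 _))// -natrB// ler1n subn_gt0//.
- move=> k l /andP[kl lm].
  have [lk|kl2] := leqP l k.+1; first by left; rewrite psi0// kl.
  right; have [u [ku ul d1 d2]] := nat_middle kl2.
  have kul : u%:R * step m - k%:R * step m <=
      2 / 3 * (l%:R * step m - k%:R * step m).
    by rewrite -!mulrBl -!natrB ?(leq_trans ku)// nat_two_thirds// ltW.
  have kul' : l%:R * step m - u%:R * step m <=
      2 / 3 * (l%:R * step m - k%:R * step m).
    by rewrite -!mulrBl -!natrB ?(leq_trans ku)// nat_two_thirds// ltW.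
  exists u; split; rewrite ?ku ?ul ?(leq_trans ul)//.
  have lT := grid_leT lm; have k0 := grid_ge0 m k; have u0 := grid_ge0 m u.
  have kuh := grid_le m ku; have ulh := grid_le m ul.
  have klh := le_trans kuh ulh.
  have lip := almost_flow_lip muF (euler x m u)
    (mu (k%:R * step m) (u%:R * step m) (euler x m k)) u0 ulh lT.
  have comp := lip1_bound (almost_flow_comp muF k0 kuh ulh lT) (euler x m k).
  rewrite /psi.
  rewrite (_ : euler x m l - _ =
    (euler x m l - mu (u%:R * step m) (l%:R * step m) (euler x m u))
    + (mu (u%:R * step m) (l%:R * step m) (euler x m u)
       - mu (u%:R * step m) (l%:R * step m)
           (mu (k%:R * step m) (u%:R * step m) (euler x m k)))
    + (mu (u%:R * step m) (l%:R * step m)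
         (mu (k%:R * step m) (u%:R * step m) (euler x m k))
       - mu (k%:R * step m) (l%:R * step m) (euler x m k))); last by abel.
  apply: le_trans (ler_normD _ _) _; apply: lerD => //.
  apply: le_trans (ler_normD _ _) _; apply: lerD => //.
  apply: (le_trans lip); apply: ler_wpM2r => //; rewrite lerD2l.
  apply: ler_wpM2l => //; apply: ge0_ler_powR; rewrite ?nnegrE ?subr_ge0//.
    exact: ltW.
  by rewrite lerD2l lerN2.
Qed.

Let index (m : nat) (t : R) : nat := Num.truncn (t / step m).

Let index_le m t : 0 <= t -> (index m t)%:R * step m <= t.
Proof.
move=> t0; rewrite -ler_pdivlMr// truncn_le divr_ge0//.
exact: ltW.
Qed.

Let index_gt m t : t - (index m t)%:R * step m <= step m.
Proof.
rewrite lerBlDl -[X in _ + X]mul1r -mulrDl natr1 -ler_pdivrMr//.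
exact: ltW (truncnS_gt _).
Qed.

Let index_leT m t : t <= T -> (index m t <= m.+1)%N.
Proof.
move=> tT; rewrite /index truncn_le_nat; apply: (@le_lt_trans _ _ m.+1%:R).
  by rewrite ler_pdivrMr// mulrCA divff ?mulr1// pnatr_eq0.
by rewrite ltr_nat.
Qed.

Let index_mono m s t : s <= t -> (index m s <= index m t)%N.
Proof. by move=> st; apply: le_truncn; rewrite ler_pM2r// invr_gt0. Qed.

Let step_small (e : R) : 0 < e -> \forall m \near \oo, step m <= e.
Proof.
move=> e0; have := near_infty_natSinv_lt (PosNum (divr_gt0 e0 T0)).
apply: filterS => m /= /ltW; rewrite ler_pdivlMr// => h.
by rewrite /step mulrC.
Qed.

(** The Euler schemes of all grids are extended to [0, T] as step functions and
    are uniformly bounded, so they converge pointwise along an ultrafilter.  The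
    expansion holds at the grid points next to s and t, and passes to the limit
    by continuity of mu in time. *)
Lemma trajectory_exists x : exists2 y : R -> 'M[R]_(p, q),
  y 0 = x & trajectory T theta mu y.
Proof.
have [U [UU sub]] := ultraFilterLemma (eventually_filter : ProperFilter \oo).
pose K := sewing_const T beta theta M * M.
have K0 : 0 <= K by rewrite mulr_ge0// sewing_const_ge0.
have theta0 : 0 <= theta by exact: ltW (lt_trans ltr01 theta1).
pose f m t := euler x m (index m t).
have fbound m t : 0 <= t -> t <= T ->
    `|f m t| <= `|x| + M * T `^ beta + K * T `^ theta.
  move=> t0 tT; have im := index_leT m tT.
  have eb := euler_bound x (leq0n _) im.
  have sT := grid_leT im; have s0 := grid_ge0 m (index m t).
  rewrite mul0r subr0 in eb.
  have nb := lip2_bound (almost_flow_near muF (lexx 0) s0 sT) x.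
  rewrite subr0 /= in nb; rewrite /f.
  set s := (index m t)%:R * step m in eb sT s0 nb.
  rewrite (_ : euler x m (index m t) = x + (mu 0 s x - x) +
    (euler x m (index m t) - mu 0 s x)); last by abel.
  apply: le_trans (ler_normD _ _) _; apply: lerD.
    apply: le_trans (ler_normD _ _) _; rewrite lerD2l; apply: (le_trans nb).
    apply: ler_wpM2l => //; apply: ge0_ler_powR; rewrite ?nnegrE//; exact: ltW.
  apply: (le_trans eb); apply: ler_wpM2l => //.
  by apply: ge0_ler_powR; rewrite ?nnegrE// ltW.
have lim t : exists l, 0 <= t <= T -> forall e : R, 0 < e ->
  \forall m \near U, `|f m t - l| <= e.
  have [/andP[t0 tT]|nt] := boolP (0 <= t <= T); last by exists 0.
  have [l lP] := ultrafilter_bounded_limit UU (fun m => fbound m t t0 tT).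
  by exists l.
have [y yP] := choice lim; exists y.
  apply/eqP; rewrite eq_sym -subr_eq0 -normr_le0; apply/ler_addgt0Pr => e e0.
  rewrite add0r; have := yP 0; rewrite lexx ltW// => /(_ isT e e0).
  move=> /filter_ex[m]; rewrite /f /index mul0r truncn0 //.
(* For a fine grid the grid points below s and t are at distance at most
   2 (t - s), hence the factor 2^theta. *)
exists (K * 2 `^ theta) => s t; have [->|st] := eqVneq s t.
  move=> t0 _ tT; rewrite (almost_flow_id beta0 muF)// subrr normr0.
  by apply: mulr_ge0; [exact: mulr_ge0 (powR_ge0 _ _)|exact: powR_ge0].
move=> s0; rewrite le_eqVlt (negPf st) /= => {}st tT.
have h0 : 0 < t - s by rewrite subr_gt0.
have sT := ltW (lt_le_trans st tT); have t0 := ltW (le_lt_trans s0 st).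
(* c collects the errors from replacing y_t, y_s by the scheme and s, t by
   grid points, when each of these is controlled by e. *)
pose c := 2 + 2 * M + M * T `^ beta.
have c0 : 0 < c by rewrite /c -addrA ltr_wpDr// addr_ge0// mulr_ge0// powR_ge0.
apply/ler_addgt0Pr => e' e'0; pose e := e' / c.
have e0 : 0 < e by rewrite divr_gt0.
have : \forall m \near U, [/\ `|f m s - y s| <= e, `|f m t - y t| <= e,
   step m <= e `^ beta^-1 & step m <= t - s].
  near=> m; split; near: m.
  - by apply: yP => //; rewrite s0 sT.
  - by apply: yP => //; rewrite t0 tT.
  - by apply: sub; apply: step_small; rewrite powR_gt0.
  - by apply: sub; apply: step_small.
move=> /filter_ex[m [fs ft se sh]].
have is_ := index_leT m sT; have it := index_leT m tT.
have ist := index_mono m (ltW st).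
have eb := euler_bound x ist it; rewrite -/(f m s) -/(f m t) in eb.
have time := almost_flow_time muF (f m s) s0 (ltW st) tT
  (grid_ge0 m (index m s)) (grid_le m ist) (grid_leT it).
have lip := almost_flow_lip muF (f m s) (y s) s0 (ltW st) tT.
have s1 := index_le m s0; have s2 := index_gt m s.
have t1 := index_le m t0; have t2 := index_gt m t.
have dist (r : R) : (index m r)%:R * step m <= r ->
    r - (index m r)%:R * step m <= step m ->
    `|r - (index m r)%:R * step m| `^ beta <= e.
  move=> r1 r2; rewrite ger0_norm ?subr_ge0//.
  have -> : e = (e `^ beta^-1) `^ beta.
    by rewrite -powRrM mulVf ?gt_eqF// powRr1// ltW.
  apply: ge0_ler_powR; rewrite ?nnegrE ?subr_ge0 ?powR_ge0//; first exact: ltW.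
  exact: le_trans se.
have ds := dist s s1 s2; have dt := dist t t1 t2.
set s' := (index m s)%:R * step m in eb time s1 s2 ds *.
set t' := (index m t)%:R * step m in eb time t1 t2 dt *.
rewrite (_ : y t - mu s t (y s) = - (f m t - y t) + (f m t - mu s' t' (f m s))
  - (mu s t (f m s) - mu s' t' (f m s)) + (mu s t (f m s) - mu s t (y s)));
  last by abel.
have th : (t' - s') `^ theta <= 2 `^ theta * (t - s) `^ theta.
  rewrite -powRM//; last exact: ltW.
  apply: ge0_ler_powR; rewrite ?nnegrE ?subr_ge0 ?grid_le//.
    by rewrite mulr_ge0// ltW.
  by rewrite mulr2n mulrDl mul1r; lra.
have hT : (t - s) `^ beta <= T `^ beta.
  apply: ge0_ler_powR; rewrite ?nnegrE ?(ltW h0) ?(ltW T0)//; first exact: ltW.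
  by rewrite lerBlDr (le_trans tT)// lerDl.
have -> : K * 2 `^ theta * (t - s) `^ theta + e' =
    e + K * (2 `^ theta * (t - s) `^ theta) + M * (e + e) +
    (1 + M * T `^ beta) * e.
  have -> : e' = c * e by rewrite mulrC divfK// gt_eqF.
  by rewrite /c; ring.
apply: le_trans (ler_normD _ _) _; apply: lerD; last first.
  apply: (le_trans lip); apply: ler_pM => //.
    by rewrite addr_ge0// mulr_ge0// powR_ge0.
  by rewrite lerD2l; apply: ler_wpM2l.
apply: le_trans (ler_normB _ _) _; apply: lerD; last first.
  by apply: (le_trans time); apply: ler_wpM2l => //; apply: lerD.
apply: le_trans (ler_normD _ _) _; apply: lerD; first by rewrite normrN.
by apply: (le_trans eb); apply: ler_wpM2l.
Unshelve. all: by end_near. Qed.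

End TrajectoryExistence.

(** * Riemann sums *)

Lemma uniform_partition (R : realType) (a h : R) (m : nat) : 0 < h ->
  exists s : seq R, [/\ path <%O a s, last a s = a + m%:R * h &
    all (fun uv => uv.2 - uv.1 <= h) (zip (a :: s) s)].
Proof.
move=> h0; elim: m a => [|m IH] a.
  by exists [::]; split; rewrite //= mul0r addr0.
have [s [ps ls gs]] := IH (a + h).
exists (a + h :: s); split=> /=.
- by rewrite ltrDl h0.
- by rewrite ls -natr1; ring.
- by rewrite gs andbT addrAC subrr add0r lexx.
Qed.

Lemma mesh_leP (R : realType) (s : seq R) (h : R) : 0 <= h ->
  reflect (all (fun uv => uv.2 - uv.1 <= h) (zip (0 :: s) s)) (mesh s <= h).
Proof.
move=> h0; rewrite /mesh; apply: (iffP idP); elim: (zip _ _) => [|uv l IH] //=.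
- by rewrite big_cons ge_max => /andP[-> /IH].
- by rewrite big_nil.
- by rewrite big_cons ge_max => /andP[-> /IH].
Qed.

#[local] Instance mesh_to0_filter (R : realType) (t : R) : Filter (mesh_to0 t).
Proof.
split; first by exists 1.
- move=> A B [a a0 Aa] [b b0 Bb]; exists (Num.min a b).
    by rewrite lt_min a0.
  move=> s st; rewrite lt_min => /andP[sa sb]; split; [exact: Aa|exact: Bb].
- by move=> A B AB [a a0 Aa]; exists a => // s st sa; apply/AB/Aa.
Qed.

(** Subdivisions of arbitrarily small mesh exist, so limits along this filter
    are unique. *)
Lemma mesh_to0_proper (R : realType) (t : R) : 0 <= t ->
  ProperFilter (mesh_to0 t).
Proof.
move=> t0; apply: Build_ProperFilter_ex => A [e e0 Ae].
pose m := (Num.truncn (t / e)).+1.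
have [t00|t0'] := eqVneq t 0.
  exists [::]; apply: Ae; last by rewrite /mesh big_nil.
  by rewrite t00; split=> /=.
have {t0'}t0 : 0 < t by rewrite lt_neqAle eq_sym t0' t0.
have h0 : 0 < t / m%:R by rewrite divr_gt0.
have [s [ps ls gs]] := uniform_partition 0 m h0.
exists s; apply: Ae.
  by split=> //; rewrite ls add0r mulrC divfK// pnatr_eq0.
apply: (@le_lt_trans _ _ (t / m%:R)); first by apply/mesh_leP => //; exact: ltW.
by rewrite ltr_pdivrMr// mulrC -ltr_pdivrMr// truncnS_gt.
Qed.

(** Each term contributes C (v - u)^theta <= C h^(theta - 1) (v - u), and the
    lengths add up. *)
Lemma riemann_sum_error (R : realType) (V : normedModType R) (T theta C h : R)
    (A : R -> R -> V) (y : R -> V) :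
  1 < theta -> 0 <= C ->
  (forall s t : R, 0 <= s -> s <= t -> t <= T ->
     `|y t - y s - A s t| <= C * (t - s) `^ theta) ->
  forall (s : seq R) (a : R), 0 <= a -> path <%O a s -> last a s <= T ->
    all (fun uv => uv.2 - uv.1 <= h) (zip (a :: s) s) ->
  `|y (last a s) - y a - \sum_(uv <- zip (a :: s) s) A uv.1 uv.2|
    <= C * h `^ (theta - 1) * (last a s - a).
Proof.
move=> th1 C0 yA; elim=> [|b s IH] a a0 /=.
  by rewrite big_nil !subrr normr0 mulr0.
move=> /andP[ab pbs] sT /andP[bah gs]; rewrite big_cons /=.
have b0 : 0 <= b by rewrite ltW// (le_lt_trans a0).
have bT : b <= T.
  by apply: le_trans sT; apply: (@itv_partition_le _ _ b _ s).
have ba0 : 0 <= b - a by rewrite subr_ge0 ltW.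
have IHb := IH b b0 pbs sT gs.
move: (\sum_(uv <- zip (b :: s) s) A uv.1 uv.2) IHb => S IHb.
rewrite (_ : y (last b s) - y a - (A a b + S) =
  (y b - y a - A a b) + (y (last b s) - y b - S)); last by abel.
rewrite (_ : last b s - a = (b - a) + (last b s - b)); last by abel.
rewrite mulrDr; apply: le_trans (ler_normD _ _) _; apply: lerD => //.
apply: (le_trans (yA _ _ a0 (ltW ab) bT)); rewrite -mulrA.
apply: ler_wpM2l => //.
rewrite (powR_subr1 th1)//; apply: ler_wpM2r => //; apply: ge0_ler_powR => //.
- by rewrite subr_ge0 ltW.
- by rewrite nnegrE (le_trans ba0).
Qed.

(** A path whose increments agree with A up to an order > 1 is the limit of the
    Riemann sums of A; to prove that a rough integral converges it is thus
    enough to exhibit such a path. *)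
Lemma riemann_sum_cvg (R : realType) (V : normedModType R) (T theta C : R)
    (A : R -> R -> V) (y : R -> V) :
  1 < theta ->
  (forall s t : R, 0 <= s -> s <= t -> t <= T ->
     `|y t - y s - A s t| <= C * (t - s) `^ theta) ->
  forall t : R, 0 <= t -> t <= T ->
  (fun s : seq R => \sum_(uv <- zip (0 :: s) s) A uv.1 uv.2) @ mesh_to0 t
    --> y t - y 0.
Proof.
move=> th1 yA t t0 tT.
have yA' s r : 0 <= s -> s <= r -> r <= T ->
    `|y r - y s - A s r| <= `|C| * (r - s) `^ theta.
  move=> s0 sr rT; apply: (le_trans (yA _ _ s0 sr rT)).
  by apply: ler_wpM2r; [exact: powR_ge0|exact: ler_norm].
apply/cvgrPdist_le => e e0.
pose D : R := `|C| * t + 1.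
have D0 : 0 < D by rewrite ltr_wpDl// mulr_ge0.
(* The mesh for which D h^(theta - 1) = e. *)
pose h : R := (e / D) `^ (theta - 1)^-1.
have h0 : 0 < h by rewrite powR_gt0// divr_gt0.
exists h => // s [ps /eqP ls] /ltW /(mesh_leP _ (ltW h0)) gs.
have := riemann_sum_error th1 (normr_ge0 C) yA' (lexx 0) ps _ gs.
rewrite ls => /(_ tT) /le_trans; apply.
have -> : h `^ (theta - 1) = e / D.
  by rewrite -powRrM mulVf ?powRr1// ?divr_ge0 ?ltW// gt_eqF// subr_gt0.
rewrite subr0 mulrAC mulrCA ler_piMr//; first exact: ltW.
by rewrite ler_pdivrMr// mul1r lerDl.
Qed.

Lemma rough_integralE (R : realType) (d n : nat) (T theta C : R)
    (W : R -> 'cV[R]_n) (WW : R -> R -> 'M[R]_n) (Z : R -> expr R n d n)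
    (y : R -> 'cV[R]_d) :
  1 < theta ->
  (forall s t : R, 0 <= s -> s <= t -> t <= T ->
     `|y t - y s - ((Z s).1 *m incr W s t + contract2 (Z s).2 (WW s t))|
       <= C * (t - s) `^ theta) ->
  forall t : R, 0 <= t -> t <= T -> rough_integral W WW Z t = y t - y 0.
Proof.
move=> th1 yA t t0 tT; have FF := mesh_to0_proper t0.
exact: (cvg_lim (@norm_hausdorff _ _) (riemann_sum_cvg th1 yA t0 tT)).
Qed.

(** * Finite differences of differentiable maps *)

(** The difference quotient at s = t of s |-> f (x + s b) is the one defining
    the directional derivative of f. *)
Lemma is_derive_line (R : realType) (V W : normedModType R) (f : V -> W)
    (x b : V) (t : R) :
  differentiable f (x + t *: b) ->
  is_derive t (1 : R) (fun s => f (x + s *: b)) ('d f (x + t *: b) b).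
Proof.
move=> df.
have quot :
    (fun h : R => h^-1 *:
      (f (x + (h *: 1 + t) *: b) - f (x + t *: b))) =
    (fun h : R => h^-1 *:
      ((f \o shift (x + t *: b)) (h *: b) - f (x + t *: b))).
  apply/funext => h; congr (_ *: (f _ - _)).
  by rewrite /shift /= [_ *: 1]mulr1 scalerDl addrCA.
have d1 := diff_derivable (v := b) df; have d2 := deriveE b df.
split; first by rewrite /derivable /= quot.
by rewrite /derive /= quot -d2.
Qed.

(** The norm is the maximum of the entries, so the real mean value theorem
    applies entry by entry. *)
Lemma mean_value_bound (R : realType) (p q : nat) (g g' : R -> 'M[R]_(p, q))
    (K : R) :
  (forall t : R, is_derive t (1 : R) g (g' t)) ->
  (forall t : R, 0 <= t -> t <= 1 -> `|g' t| <= K) -> `|g 1 - g 0| <= K.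
Proof.
move=> dg gK; have K0 : 0 <= K by apply: le_trans (gK 0 (lexx 0) ler01).
apply: mx_norm_ler => // i j; rewrite !mxE.
have dij (t : R) : is_derive t (1 : R) (fun s => g s i j) (g' t i j).
  have [der val] := dg t; split; first exact: (derivable_mxP _ _ _).1 der i j.
  by rewrite -val (derive_mx der) mxE.
have [|c] := @MVT_segment R (fun s => g s i j) (fun s => g' s i j) 0 1 ler01
    (fun t _ => dij t).
  apply: continuous_subspaceT => t.
  by apply/differentiable_continuous/derivable1_diffP; have [] := dij t.
rewrite in_itv /= => /andP[c0 c1] ->; rewrite subr0 mulr1.
exact: le_trans (ler_mx_norm _ _ _) (gK c c0 c1).
Qed.

Lemma is_derive_scale (R : realType) (W : normedModType R) (c : W) (t : R) :
  is_derive t (1 : R) (fun s : R => s *: c) c.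
Proof.
have dc : differentiable ( *:%R ^~ c : R -> _) t by [].
split; first exact: diff_derivable dc.
by rewrite deriveE// diff_val scale1r.
Qed.

Section MeanValue.
Variables (R : realType) (V : normedModType R) (p q : nat).
Variable f : V -> 'M[R]_(p, q).
Hypothesis df : forall x, differentiable f x.

Lemma mean_value_increment (x b : V) (c : 'M[R]_(p, q)) (K : R) :
  (forall t : R, 0 <= t -> t <= 1 -> `|'d f (x + t *: b) b - c| <= K) ->
  `|f (x + b) - f x - c| <= K.
Proof.
move=> H.
have dg (t : R) : is_derive t (1 : R) (fun s : R => f (x + s *: b) - s *: c)
    ('d f (x + t *: b) b - c).
  have h := is_derive_line (df (x + t *: b)).
  have h2 := is_derive_scale c t.
  exact: is_deriveB.
have := mean_value_bound dg H.
by rewrite !scale1r !scale0r addr0 subr0 addrAC.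
Qed.

Lemma mean_value_difference (x y b : V) (c : 'M[R]_(p, q)) (K : R) :
  (forall t : R, 0 <= t -> t <= 1 ->
     `|'d f (x + t *: b) b - 'd f (y + t *: b) b - c| <= K) ->
  `|f (x + b) - f (y + b) - (f x - f y) - c| <= K.
Proof.
move=> H.
have dg (t : R) : is_derive t (1 : R)
    (fun s : R => f (x + s *: b) - f (y + s *: b) - s *: c)
    ('d f (x + t *: b) b - 'd f (y + t *: b) b - c).
  have h1 := is_derive_line (df (x + t *: b)).
  have h2 := is_derive_line (df (y + t *: b)).
  have h3 := is_derive_scale c t.
  exact: (is_deriveB (is_deriveB h1 h2) h3).
have := mean_value_bound dg H.
rewrite !scale1r !scale0r !addr0 subr0 => h; apply: le_trans h.
by rewrite le_eqVlt; apply/orP; left; apply/eqP; congr `|_|; abel.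
Qed.

Lemma lipschitz_diff (c : R) : (forall x v, `|'d f x v| <= c * `|v|) ->
  forall x y, `|f x - f y| <= c * `|x - y|.
Proof.
move=> fc x y; have := @mean_value_increment y (x - y) 0 (c * `|x - y|).
rewrite subr0 (_ : y + (x - y) = x); last by abel.
by apply=> t _ _; rewrite subr0.
Qed.

(** The second difference of f along a and b is the increment along b of
    f (. + a) - f, whose derivative is a difference of derivatives of f. *)
Lemma lip2_diff (c : R) : (forall x, `|f x| <= c) ->
  (forall x v, `|'d f x v| <= c * `|v|) ->
  (forall x y v, `|'d f x v - 'd f y v| <= c * `|v| * `|x - y|) ->
  lip2 c f.
Proof.
move=> f0 f1 f2; split=> //; first exact: lipschitz_diff.
move=> x a b; have := @mean_value_difference (x + a) x b 0 (c * `|a| * `|b|).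
rewrite subr0 (_ : _ - (f (x + a) - f x) =
  f (x + a + b) - f (x + a) - f (x + b) + f x); last by abel.
apply=> t _ _; rewrite subr0 mulrAC; apply: (le_trans (f2 _ _ _)).
by rewrite (_ : x + a + t *: b - (x + t *: b) = a)//; abel.
Qed.
End MeanValue.

Definition taylor_remainder (R : realType) (V : normedModType R) (p q : nat)
  (f : V -> 'M[R]_(p, q)) (x a : V) : 'M[R]_(p, q) :=
  f (x + a) - f x - 'd f x a.

Section TaylorRemainder.
Variables (R : realType) (V : normedModType R) (p q : nat).
Variables (f : V -> 'M[R]_(p, q)) (c : R).
Hypothesis df : forall x, differentiable f x.
Hypothesis d2f : forall v, lip2 (c * `|v|) (fun x => 'd f x v).
Hypothesis c0 : 0 <= c.

Lemma taylor_remainder_bound x a : `|taylor_remainder f x a| <= c * `|a| ^+ 2.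
Proof.
apply: mean_value_increment => // t t0 t1.
apply: (le_trans (lip2_lip (d2f a) _ _)); rewrite addrAC subrr add0r normrZ.
rewrite ger0_norm// (_ : c * `|a| * (t * `|a|) = t * (c * `|a| ^+ 2));
  last by ring.
by rewrite ler_piMl// !mulr_ge0.
Qed.

(** The smallness in a stays quadratic when the base point varies, at the cost
    of a second difference of x |-> f'(x) a, that is of a third derivative. *)
Lemma taylor_remainder_base x y a :
  `|taylor_remainder f x a - taylor_remainder f y a|
    <= c * `|a| ^+ 2 * `|x - y|.
Proof.
rewrite /taylor_remainder.
rewrite (_ : _ - _ = f (x + a) - f (y + a) - (f x - f y) -
  ('d f x a - 'd f y a));
  last by abel.
apply: mean_value_difference => // t t0 t1.
apply: (le_trans (lip2_four x y (t *: a) (t *: a) (d2f a))).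
rewrite subrr normr0 mulr0 addr0 normrZ ger0_norm//.
rewrite (_ : c * `|a| * `|x - y| * (t * `|a|) = t * (c * `|a| ^+ 2 * `|x - y|)).
  by rewrite ler_piMl// !mulr_ge0.
ring.
Qed.

(** With R for the remainder,
      R(x, a) - R(x, b) = R(x + b, a - b) + (f'(x + b) - f'(x))(a - b). *)
Lemma taylor_remainder_incr x a b :
  `|taylor_remainder f x a - taylor_remainder f x b|
    <= c * (`|a - b| + `|b|) * `|a - b|.
Proof.
have -> : taylor_remainder f x a - taylor_remainder f x b =
    taylor_remainder f (x + b) (a - b) +
    ('d f (x + b) (a - b) - 'd f x (a - b)).
  rewrite /taylor_remainder (_ : x + b + (a - b) = x + a); last by abel.
  have -> : 'd f x (a - b) = 'd f x a - 'd f x b by rewrite linearB.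
  (* Both occurrences of this derivative become a single atom. *)
  move: ('d f (x + b) (a - b)) => D.
  abel.
apply: le_trans (ler_normD _ _) _; rewrite mulrDr mulrDl; apply: lerD.
  by rewrite -mulrA -expr2 taylor_remainder_bound.
apply: (le_trans (lip2_lip (d2f _) _ _)).
rewrite (_ : x + b - x = b); last by abel.
by rewrite [leLHS]mulrAC.
Qed.
End TaylorRemainder.

(** * Algebra of the finite difference classes *)

Lemma mulmx_norm (R : realType) (p q r : nat) (A : 'M[R]_(p, q))
    (B : 'M[R]_(q, r)) : `|A *m B| <= q%:R * `|A| * `|B|.
Proof.
apply: mx_norm_ler => [|i j]; first by rewrite !mulr_ge0.
rewrite mxE; apply: le_trans (ler_norm_sum _ _ _) _.
apply: (@le_trans _ _ (\sum_(k < q) `|A| * `|B|)).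
  apply: ler_sum => k _; rewrite normrM; apply: ler_pM => //;
    exact: ler_mx_norm.
by rewrite sumr_const card_ord -[leLHS]mulr_natl mulrA.
Qed.

Lemma norm_delta_mx (R : realType) (p q : nat) i j :
  `|delta_mx i j : 'M[R]_(p, q)| <= 1.
Proof.
apply: mx_norm_ler => // k l; rewrite mxE.
by case: (_ && _); rewrite ?normr1 ?normr0.
Qed.

Section Lip2Algebra.
Variables (R : realType) (V W W' : normedModType R).

Lemma lip2_le (c c' : R) (f : V -> W) : c <= c' -> lip2 c f -> lip2 c' f.
Proof.
move=> cc' [f0 f1 f2]; split.
- by move=> x; apply: le_trans cc'.
- by move=> x y; apply: (le_trans (f1 x y)); apply: ler_wpM2r.
- move=> x a b; apply: (le_trans (f2 x a b)).
  by apply: ler_wpM2r => //; apply: ler_wpM2r.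
Qed.

Lemma lip2_cst (w : W) : lip2 `|w| (fun _ : V => w).
Proof.
by split=> *; rewrite ?subrr ?sub0r ?addNr ?normr0 ?mulr_ge0.
Qed.

Lemma lip2_add (c c' : R) (f g : V -> W) :
  lip2 c f -> lip2 c' g -> lip2 (c + c') (fun x => f x + g x).
Proof.
move=> [f0 f1 f2] [g0 g1 g2]; split.
- by move=> x; rewrite (le_trans (ler_normD _ _))// lerD.
- move=> x y; rewrite (_ : _ - _ = (f x - f y) + (g x - g y)); last by abel.
  by rewrite mulrDl (le_trans (ler_normD _ _))// lerD.
- move=> x a b; rewrite !mulrDl.
  rewrite [X in `|X|](_ : _ = (f (x + a + b) - f (x + a) - f (x + b) + f x) +
    (g (x + a + b) - g (x + a) - g (x + b) + g x)); last by abel.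
  by rewrite (le_trans (ler_normD _ _))// lerD.
Qed.

Lemma lip2_sum (I : finType) (c : I -> R) (f : I -> V -> W) :
  (forall i, lip2 (c i) (f i)) -> lip2 (\sum_i c i) (fun x => \sum_i f i x).
Proof.
move=> fc; elim: (index_enum I) => [|i r IH].
  rewrite big_nil (_ : (fun _ => _) = fun=> 0); last first.
    by apply/funext => x; rewrite big_nil.
  by have := lip2_cst (0 : W); rewrite normr0.
rewrite big_cons (_ : (fun _ => _) = fun x => f i x + \sum_(j <- r) f j x).
  exact: lip2_add.
by apply/funext => x; rewrite big_cons.
Qed.

Lemma lip2_comp (k c : R) (L : W -> W') (f : V -> W) : 0 <= k ->
  (forall u v, L (u - v) = L u - L v) -> (forall u, `|L u| <= k * `|u|) ->
  lip2 c f -> lip2 (k * c) (fun x => L (f x)).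
Proof.
move=> k0 LB Lk [f0 f1 f2]; split.
- by move=> x; apply: (le_trans (Lk _)); apply: ler_wpM2l.
- by move=> x y; rewrite -LB -mulrA; apply: (le_trans (Lk _)); apply: ler_wpM2l.
- move=> x a b; rewrite -!mulrA.
  rewrite (_ : _ + _ = L (f (x + a + b) - f (x + a)) - L (f (x + b) - f x)).
    rewrite -LB; apply: (le_trans (Lk _)); apply: ler_wpM2l => //.
    rewrite (_ : _ - _ = f (x + a + b) - f (x + a) - f (x + b) + f x) ?mulrA//.
    abel.
  rewrite !LB; abel.
Qed.

(** The product rule: B is linear in its second argument, and the first and
    second differences of x |-> B x (f x) expand by the Leibniz formula, the
    second one into four terms. *)
Lemma lip2_apply (c c' : R) (B : V -> W -> W') (f : V -> W) : 0 <= c ->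
  (forall x u v, B x (u - v) = B x u - B x v) ->
  (forall u, lip2 (c * `|u|) (fun x => B x u)) ->
  lip2 c' f -> lip2 (4 * (c * c')) (fun x => B x (f x)).
Proof.
move=> c0 BB Bc fc; have c'0 := lip2_ge0 fc.
have [f0 f1 f2] := fc.
have cc'0 : 0 <= c * c' by exact: mulr_ge0.
have B0 x u K : `|u| <= K -> `|B x u| <= c * K.
  by move=> uK; apply: (le_trans (lip2_bound (Bc u) x)); apply: ler_wpM2l.
have B1 x y u K : `|u| <= K -> `|B x u - B y u| <= c * `|x - y| * K.
  move=> uK; apply: (le_trans (lip2_lip (Bc u) x y)); rewrite mulrAC.
  by apply: ler_wpM2l => //; exact: mulr_ge0.
split.
- move=> x; apply: (le_trans (B0 _ _ _ (f0 x))).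
  by rewrite ler_peMl// ler1n.
- move=> x y.
  rewrite (_ : _ - _ = (B x (f x) - B y (f x)) + B y (f x - f y)); last first.
    by rewrite BB; abel.
  have b1 := B1 x y _ _ (f0 x); have b2 := B0 y _ _ (f1 x y).
  rewrite (le_trans (ler_normD _ _))// (le_trans (lerD b1 b2))//.
  rewrite (_ : _ + _ = 2 * (c * c' * `|x - y|)); last by ring.
  by rewrite -[leRHS]mulrA ler_wpM2r ?mulr_ge0// ler_nat.
- move=> x a b.
  (* The four corners of the parallelogram on which the second difference is
     taken. *)
  pose u00 := f x; pose u10 := f (x + a); pose u01 := f (x + b).
  pose u11 := f (x + a + b).
  rewrite (_ : _ + _ =
    (B (x + a + b) u11 - B (x + a) u11 - B (x + b) u11 + B x u11) +
    (B (x + a) (u11 - u10) - B x (u11 - u10)) +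
    (B (x + b) (u11 - u01) - B x (u11 - u01)) +
    B x (u11 - u10 - u01 + u00)); last first.
    have BD z u v : B z (u + v) = B z u + B z v.
      have BN w : B z (- w) = - B z w.
        have B00 : B z 0 = 0 by rewrite -(subrr 0) BB subrr.
        by rewrite -[- w]add0r BB B00 add0r.
      by rewrite -[v]opprK BB !BN.
    by rewrite !BB BD !BB /u11 /u10 /u01 /u00; abel.
  have t1 := lip2_diff2 (Bc u11) x a b.
  have {}t1 : `|B (x + a + b) u11 - B (x + a) u11 - B (x + b) u11 + B x u11|
      <= c * c' * (`|a| * `|b|).
    apply: (le_trans t1); rewrite -mulrA; apply: ler_wpM2r;
      first exact: mulr_ge0.
    by apply: ler_wpM2l => //; exact: f0.
  have da : `|u11 - u01| <= c' * `|a|.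
    by apply: (le_trans (f1 _ _)); rewrite (_ : x + a + b - (x + b) = a) //;
      abel.
  have db : `|u11 - u10| <= c' * `|b|.
    by apply: (le_trans (f1 _ _)); rewrite (_ : x + a + b - (x + a) = b)//;
      abel.
  have t2 := B1 (x + a) x _ _ db; rewrite (_ : x + a - x = a) in t2;
    last by abel.
  have t3 := B1 (x + b) x _ _ da; rewrite (_ : x + b - x = b) in t3;
    last by abel.
  have t4 := B0 x _ _ (f2 x a b); rewrite -/u11 -/u10 -/u01 -/u00 in t4.
  rewrite (_ : 4 * (c * c') * `|a| * `|b| = c * c' * (`|a| * `|b|) +
    c * `|a| * (c' * `|b|) + c * `|b| * (c' * `|a|) + c * (c' * `|a| * `|b|));
    last by ring.
  apply: le_trans (ler_normD _ _) _; apply: lerD => //.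
  apply: le_trans (ler_normD _ _) _; apply: lerD => //.
  by apply: le_trans (ler_normD _ _) _; apply: lerD.
Qed.
End Lip2Algebra.

(** * The Davie increment *)

Lemma contract2D (R : realType) (d n : nat) (b : 'Hom('cV[R]_n, 'M[R]_(d, n)))
    (A B : 'M[R]_n) : contract2 b (A + B) = contract2 b A + contract2 b B.
Proof.
rewrite /contract2 -big_split; apply: eq_bigr => i _ /=.
by rewrite -big_split; apply: eq_bigr => j _ /=; rewrite mxE scalerDl.
Qed.

(** On a pure tensor the contraction is the iterated evaluation; with Chen's
    relation this is what cancels the terms of order 2 beta in the composition
    defect. *)
Lemma contract2_tensor (R : realType) (d n : nat)
    (b : 'Hom('cV[R]_n, 'M[R]_(d, n))) (v w : 'cV[R]_n) :
  contract2 b (v *m w^T) = b v *m w.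
Proof.
have basis (u : 'cV[R]_n) : u = \sum_i u i 0 *: delta_mx i 0.
  apply/matrixP => i j; rewrite (ord1 j) summxE (bigD1 i)//= big1 ?addr0.
    by rewrite !mxE !eqxx mulr1.
  by move=> k ki; rewrite !mxE eq_sym (negPf ki) mulr0.
have -> : b v = \sum_i v i 0 *: b (delta_mx i 0).
  by rewrite {1}(basis v) linear_sum; apply: eq_bigr => i _; rewrite linearZ.
rewrite mulmx_suml; apply: eq_bigr => i _.
rewrite [X in _ = _ *m X](basis w) mulmx_sumr; apply: eq_bigr => j _.
rewrite -scalemxAl -scalemxAr scalerA.
by rewrite mxE big_ord1 !mxE.
Qed.

Lemma addr3B (V : zmodType) (a b c a' b' c' : V) :
  a + b + c - (a' + b' + c') = (a - a') + (b - b') + (c - c').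
Proof. abel. Qed.

Lemma subrACB (V : zmodType) (a b c d : V) : a - b - (c - d) = a - c - (b - d).
Proof. abel. Qed.

Lemma mulr3Dl (R : pzRingType) (a b c x : R) :
  (a + b + c) * x = a * x + b * x + c * x.
Proof. by rewrite !mulrDl. Qed.

(** A factor n is the price of the maximum norm in a product of matrices. *)
Definition field1_const (R : realType) (n : nat) (C : R) : R := n%:R * C.

Definition field2_const (R : realType) (n : nat) (C : R) : R :=
  n%:R * (n%:R * (4 * (field1_const n C * field1_const n C))).

Section DrivenField.
Variables (R : realType) (d n : nat) (F : 'cV[R]_d -> 'M[R]_(d, n)) (C : R).
Hypothesis C0 : 0 <= C.
Hypothesis dF : forall x, differentiable F x.
Hypothesis F_lip2 : lip2 C F.
Hypothesis dF_lip2 : forall v, lip2 (C * `|v|) (fun x => 'd F x v).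

Definition field1 (w : 'cV[R]_n) (x : 'cV[R]_d) : 'cV[R]_d := F x *m w.

Definition dfield1 (w : 'cV[R]_n) (x v : 'cV[R]_d) : 'cV[R]_d := 'd F x v *m w.

(** F'(x)F(x) contracted with a second-level increment A. *)
Definition field2 (A : 'M[R]_n) (x : 'cV[R]_d) : 'cV[R]_d :=
  contract2 (linfun ('d F x) \o linfun (mulmx (F x)))%VF A.

Local Notation c1 := (field1_const n C).
Local Notation c2 := (field2_const n C).

Lemma field1_const_ge0 : 0 <= c1. Proof. exact: mulr_ge0. Qed.

Lemma field2_const_ge0 : 0 <= c2.
Proof. by rewrite !mulr_ge0// field1_const_ge0. Qed.

Let c1_ge0 := field1_const_ge0.
Let c2_ge0 := field2_const_ge0.

Lemma lip2_mulmx (c : R) (G : 'cV[R]_d -> 'M[R]_(d, n)) (w : 'cV[R]_n) :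
  lip2 c G -> lip2 (n%:R * c * `|w|) (fun x => G x *m w).
Proof.
move=> Gc; rewrite mulrAC.
apply: (@lip2_comp _ _ _ _ _ _ (fun A : 'M[R]_(d, n) => A *m w)) Gc.
- exact: mulr_ge0.
- by move=> u v; rewrite mulmxBl.
- by move=> u; apply: (le_trans (mulmx_norm _ _)); rewrite mulrAC.
Qed.

Lemma field1_lip2 w : lip2 (c1 * `|w|) (field1 w).
Proof. exact: lip2_mulmx. Qed.

Lemma dfield1_lip2 w v : lip2 (c1 * `|w| * `|v|) (fun x => dfield1 w x v).
Proof.
rewrite (_ : _ * _ = n%:R * (C * `|v|) * `|w|); first exact: lip2_mulmx.
by rewrite /field1_const; ring.
Qed.

Lemma dfield1B w x u v : dfield1 w x (u - v) = dfield1 w x u - dfield1 w x v.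
Proof. by rewrite /dfield1 linearB mulmxBl. Qed.

Lemma driving_homE x v :
  (linfun ('d F x) \o linfun (mulmx (F x)))%VF v = 'd F x (F x *m v).
Proof.
by rewrite comp_lfunE (lfunE (mulmx (F x))) /= lfunE.
Qed.

Lemma field2E A x : field2 A x =
  \sum_i \sum_j A i j *: dfield1 (delta_mx j 0) x (field1 (delta_mx i 0) x).
Proof.
rewrite /field2 /contract2; apply: eq_bigr => i _; apply: eq_bigr => j _.
by rewrite driving_homE.
Qed.

Lemma field2D A B x : field2 (A + B) x = field2 A x + field2 B x.
Proof. exact: contract2D. Qed.

Lemma field2_tensor v w x : field2 (v *m w^T) x = dfield1 w x (field1 v x).
Proof. by rewrite /field2 contract2_tensor driving_homE. Qed.

Lemma field1D v w x : field1 (v + w) x = field1 v x + field1 w x.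
Proof. exact: mulmxDr. Qed.

Lemma dfield1_apply_lip2 (c : R) w (f : 'cV[R]_d -> 'cV[R]_d) : lip2 c f ->
  lip2 (4 * (c1 * `|w| * c)) (fun x => dfield1 w x (f x)).
Proof.
move=> fc; apply: lip2_apply fc.
- by rewrite mulr_ge0.
- exact: dfield1B.
- exact: dfield1_lip2.
Qed.

Lemma field2_lip2 A : lip2 (c2 * `|A|) (field2 A).
Proof.
have -> : field2 A = fun x =>
    \sum_i \sum_j A i j *: dfield1 (delta_mx j 0) x (field1 (delta_mx i 0) x).
  by apply/funext => x; rewrite field2E.
have -> : c2 * `|A| = \sum_(i < n) \sum_(j < n) (`|A| * (4 * (c1 * c1))).
  have sumE (x : R) : \sum_(i < n) x = n%:R * x.
    by rewrite sumr_const card_ord mulr_natl.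
  by rewrite sumE sumE /field2_const; ring.
apply: lip2_sum => i; apply: lip2_sum => j.
have entry (c : R) (f : 'cV[R]_d -> 'cV[R]_d) : lip2 c f ->
  lip2 (`|A| * c) (fun x => A i j *: f x).
  move=> fc; apply: lip2_le (_ : `|A i j| * c <= _) _.
    by apply: ler_wpM2r; [exact: lip2_ge0 fc|exact: ler_mx_norm].
  apply: (@lip2_comp _ _ _ _ _ _ (fun v => A i j *: v)) fc => //;
    first by move=> u v; rewrite scalerBr.
  by move=> u; rewrite normrZ.
apply: entry; apply: lip2_le (dfield1_apply_lip2 _ (field1_lip2 _)).
rewrite ler_wpM2l//; apply: ler_pM; rewrite ?mulr_ge0//.
- by rewrite ler_piMr// norm_delta_mx.
- by rewrite ler_piMr// norm_delta_mx.
Qed.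

Lemma dfield1_bound w x v : `|dfield1 w x v| <= c1 * `|w| * `|v|.
Proof. exact: lip2_bound (dfield1_lip2 w v) x. Qed.

Lemma remainder_bound (w : 'cV[R]_n) x a :
  `|taylor_remainder F x a *m w| <= c1 * `|w| * `|a| ^+ 2.
Proof.
apply: (le_trans (mulmx_norm _ _)); rewrite /field1_const.
rewrite (_ : n%:R * C * _ * _ = n%:R * (C * `|a| ^+ 2) * `|w|); last by ring.
apply: ler_wpM2r => //; apply: ler_wpM2l => //.
exact: taylor_remainder_bound.
Qed.

Lemma remainder_lip (w : 'cV[R]_n) x y a b :
  `|taylor_remainder F x a *m w - taylor_remainder F y b *m w| <=
    c1 * `|w| * (`|a| ^+ 2 * `|x - y| + (`|a - b| + `|b|) * `|a - b|).
Proof.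
rewrite -mulmxBl; apply: (le_trans (mulmx_norm _ _)); rewrite /field1_const.
rewrite (_ : n%:R * C * _ * _ = n%:R * (C * `|a| ^+ 2 * `|x - y| +
  C * (`|a - b| + `|b|) * `|a - b|) * `|w|); last by ring.
apply: ler_wpM2r => //; apply: ler_wpM2l => //.
rewrite [X in `|X|](_ : _ = (taylor_remainder F x a - taylor_remainder F y a) +
  (taylor_remainder F y a - taylor_remainder F y b)); last by abel.
apply: le_trans (ler_normD _ _) _; apply: lerD.
  exact: taylor_remainder_base.
exact: taylor_remainder_incr.
Qed.

Definition davie_incr (w : 'cV[R]_n) (A : 'M[R]_n) (x : 'cV[R]_d) : 'cV[R]_d :=
  field1 w x + field2 A x.

Lemma davie_incr_lip2 (K L h : R) w A : 0 <= K -> 0 <= h -> h <= L ->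
  `|w| <= K * h -> `|A| <= K * h ^+ 2 ->
  lip2 ((c1 * K + c2 * K * L) * h) (davie_incr w A).
Proof.
move=> K0 h0 hL wK AK; apply: lip2_le (lip2_add (field1_lip2 w)
  (field2_lip2 A)).
rewrite mulrDl; apply: lerD; first by rewrite -(mulrA c1 K) ler_wpM2l.
rewrite -(mulrA c2 K) -(mulrA c2 (K * L)); apply: ler_wpM2l => //.
apply: (le_trans AK); rewrite -(mulrA K L); apply: ler_wpM2l => //.
by rewrite expr2 ler_wpM2r.
Qed.

(** The tensor from Chen's relation cancels F'(x)F(x) w1 in the expansion of
    F(x + a) w2, a being the first increment.  What remains is the Taylor
    remainder of F, the action of F' on the second-level part of a, and an
    increment of the second-level coefficient: all three are of order 3. *)
Lemma davie_incr_defect w1 w2 A1 A2 x :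
  x + davie_incr w1 A1 x + davie_incr w2 A2 (x + davie_incr w1 A1 x) -
    (x + davie_incr (w1 + w2) (A1 + A2 + w1 *m w2^T) x) =
  taylor_remainder F x (davie_incr w1 A1 x) *m w2
  + dfield1 w2 x (field2 A1 x)
  + (field2 A2 (x + davie_incr w1 A1 x) - field2 A2 x).
Proof.
rewrite {2 4}/davie_incr field1D !field2D field2_tensor.
have -> : taylor_remainder F x (davie_incr w1 A1 x) *m w2 =
    field1 w2 (x + davie_incr w1 A1 x) - field1 w2 x
    - (dfield1 w2 x (field1 w1 x) + dfield1 w2 x (field2 A1 x)).
  by rewrite /taylor_remainder !mulmxBl /field1 /dfield1 -mulmxDl -linearD.
by rewrite {1}/davie_incr; abel.
Qed.

(** Here h stands for |t - s|^beta: w and A are of order h and h^2, and each of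
    the three terms of [davie_incr_defect] is of order h^3. *)
Lemma davie_incr_defect_bound (K L : R) : 0 <= K -> 0 <= L ->
  exists2 M : R, 0 <= M & forall (h : R) w1 w2 A1 A2, 0 <= h -> h <= L ->
    `|w1| <= K * h -> `|w2| <= K * h ->
    `|A1| <= K * h ^+ 2 -> `|A2| <= K * h ^+ 2 ->
    lip1 (M * h ^+ 3) (fun x => x + davie_incr w1 A1 x +
      davie_incr w2 A2 (x + davie_incr w1 A1 x) -
      (x + davie_incr (w1 + w2) (A1 + A2 + w1 *m w2^T) x)).
Proof.
move=> K0 L0; pose D : R := c1 * K + c2 * K * L.
have D0 : 0 <= D by apply: addr_ge0; rewrite ?mulr_ge0// mulr_ge0.
have c1K0 : 0 <= c1 * K by exact: mulr_ge0.
have c2K0 : 0 <= c2 * K by exact: mulr_ge0.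
have M1 : 0 <= c1 * K * (4 * D ^+ 2) by rewrite mulr_ge0// mulr_ge0// exprn_ge0.
have M2 : 0 <= 4 * (c1 * K * (c2 * K)) by rewrite mulr_ge0// mulr_ge0.
have M3 : 0 <= c2 * K * (2 * D) by rewrite mulr_ge0// mulr_ge0.
exists (c1 * K * (4 * D ^+ 2) + 4 * (c1 * K * (c2 * K)) + c2 * K * (2 * D)).
  by rewrite addr_ge0// addr_ge0.
move=> h w1 w2 A1 A2 h0 hL w1K w2K A1K A2K.
have a1D := davie_incr_lip2 K0 h0 hL w1K A1K; rewrite -/D in a1D.
have Dh0 : 0 <= D * h by exact: mulr_ge0.
have [a1b a1l _] := a1D.
have c1w : c1 * `|w2| <= c1 * K * h by rewrite -(mulrA c1 K) ler_wpM2l.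
have c2A : c2 * `|A2| <= c2 * K * h ^+ 2 by rewrite -(mulrA c2 K) ler_wpM2l.
have c1w0 : 0 <= c1 * `|w2| by exact: mulr_ge0.
have c2A0 : 0 <= c2 * `|A2| by exact: mulr_ge0.
have g2 := dfield1_apply_lip2 w2 (field2_lip2 A1).
have {}g2 : lip2 (4 * (c1 * K * (c2 * K)) * h ^+ 3)
    (fun x => dfield1 w2 x (field2 A1 x)).
  apply: lip2_le g2; rewrite [leRHS](_ : _ =
    4 * (c1 * K * h * (c2 * (K * h ^+ 2)))); last by ring.
  by rewrite ler_wpM2l//; apply: ler_pM => //;
    [exact: mulr_ge0|rewrite ler_wpM2l].
have g3 := field2_lip2 A2.
under eq_fun do rewrite davie_incr_defect.
split.
- move=> x /=.
  rewrite mulr3Dl; apply: le_trans (ler_normD _ _) _; apply: lerD.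
    apply: le_trans (ler_normD _ _) _; apply: lerD; last exact: lip2_bound g2 x.
    apply: (le_trans (remainder_bound _ _ _)).
    rewrite [leRHS](_ : _ = c1 * K * h * (4 * (D * h) ^+ 2)); last by ring.
    apply: ler_pM => //.
    apply: (@le_trans _ _ ((D * h) ^+ 2)); first by rewrite lerXn2r// nnegrE.
    by rewrite ler_peMl ?exprn_ge0// ler1n.
  apply: (le_trans (lip2_lip g3 _ _)); rewrite addrAC subrr add0r.
  rewrite [leRHS](_ : _ = c2 * K * h ^+ 2 * (2 * (D * h))); last by ring.
  apply: ler_pM => //; apply: (le_trans (a1b x)).
  by rewrite ler_peMl// ler1n.
- move=> x y /=; rewrite addr3B.
  have xy0 : 0 <= `|x - y| by [].
  have al := a1l x y.
  have al' : `|davie_incr w1 A1 x - davie_incr w1 A1 y| <= 2 * (D * h).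
    apply: le_trans (ler_normB _ _) _.
    by rewrite mulr2n mulrDl mul1r lerD.
  have bx := a1b x; have by_ := a1b y.
  rewrite mulr3Dl mulr3Dl; apply: le_trans (ler_normD _ _) _; apply: lerD.
    apply: le_trans (ler_normD _ _) _; apply: lerD; last exact: lip2_lip g2 x y.
    apply: (le_trans (remainder_lip _ _ _ _ _)).
    rewrite [leRHS](_ : _ = c1 * K * h *
      ((D * h) ^+ 2 * `|x - y| + (2 * (D * h) + D * h) * (D * h * `|x - y|)));
      last by ring.
    apply: ler_pM => //.
    apply: lerD; first by rewrite ler_wpM2r// lerXn2r// nnegrE.
    by apply: ler_pM => //; exact: lerD.
  rewrite subrACB; apply: (le_trans (lip2_four _ _ _ _ g3)).
  rewrite [leRHS](_ : _ = c2 * K * h ^+ 2 * `|x - y| * (D * h) +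
    c2 * K * h ^+ 2 * (D * h * `|x - y|)); last by ring.
  apply: lerD; last exact: ler_pM.
  by apply: ler_pM => //; [exact: mulr_ge0|exact: ler_wpM2r].
Qed.

(** The same cancellation when y2 is not the result of a Davie step from y1 but
    only agrees with its first-level part up to order 2, as the values of a
    modelled distribution do. *)
Lemma davie_incr_controlled (K B h : R) w1 w2 A1 A2 y1 y2 :
  0 <= K -> 0 <= B -> 0 <= h ->
  `|w2| <= K * h -> `|A2| <= K * h ^+ 2 ->
  `|y2 - y1| <= B * h -> `|y2 - y1 - field1 w1 y1| <= B * h ^+ 2 ->
  `|davie_incr w1 A1 y1 + davie_incr w2 A2 y2 -
      davie_incr (w1 + w2) (A1 + A2 + w1 *m w2^T) y1| <=
    (c1 * K * B ^+ 2 + c1 * K * B + c2 * K * B) * h ^+ 3.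
Proof.
move=> K0 B0 h0 w2K A2K yB rB.
have -> : davie_incr w1 A1 y1 + davie_incr w2 A2 y2 -
      davie_incr (w1 + w2) (A1 + A2 + w1 *m w2^T) y1 =
  taylor_remainder F y1 (y2 - y1) *m w2
  + dfield1 w2 y1 (y2 - y1 - field1 w1 y1) + (field2 A2 y2 - field2 A2 y1).
  rewrite /davie_incr field1D !field2D field2_tensor dfield1B.
  have -> : taylor_remainder F y1 (y2 - y1) *m w2 =
      field1 w2 y2 - field1 w2 y1 - dfield1 w2 y1 (y2 - y1).
    have e : y1 + (y2 - y1) = y2 by abel.
    by rewrite /taylor_remainder e !mulmxBl.
  by abel.
have c1w : c1 * `|w2| <= c1 * K * h by rewrite -(mulrA c1 K) ler_wpM2l.
have c2A : c2 * `|A2| <= c2 * K * h ^+ 2 by rewrite -(mulrA c2 K) ler_wpM2l.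
have c1w0 : 0 <= c1 * `|w2| by exact: mulr_ge0.
have c2A0 : 0 <= c2 * `|A2| by exact: mulr_ge0.
have Bh0 : 0 <= B * h by exact: mulr_ge0.
rewrite mulr3Dl; apply: le_trans (ler_normD _ _) _; apply: lerD.
  apply: le_trans (ler_normD _ _) _; apply: lerD.
    apply: (le_trans (remainder_bound _ _ _)).
    rewrite [leRHS](_ : _ = c1 * K * h * (B * h) ^+ 2); last by ring.
    by apply: ler_pM => //; rewrite ?exprn_ge0// lerXn2r// nnegrE.
  apply: (le_trans (dfield1_bound _ _ _)).
  rewrite [leRHS](_ : _ = c1 * K * h * (B * h ^+ 2)); last by ring.
  exact: ler_pM.
apply: (le_trans (lip2_lip (field2_lip2 A2) _ _)).
rewrite [leRHS](_ : _ = c2 * K * h ^+ 2 * (B * h)); last by ring.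
exact: ler_pM.
Qed.

Lemma davie_incr_diff w w' A A' x x' :
  `|davie_incr w A x - davie_incr w' A' x'| <=
    c1 * `|w - w'| + c2 * `|A - A'| + (c1 * `|w'| + c2 * `|A'|) * `|x - x'|.
Proof.
rewrite /davie_incr [X in `|X|](_ : _ = field1 (w - w') x + field2 (A - A') x +
  ((field1 w' x + field2 A' x) - (field1 w' x' + field2 A' x'))).
  apply: le_trans (ler_normD _ _) _; apply: lerD.
    apply: le_trans (ler_normD _ _) _; apply: lerD.
      exact: lip2_bound (field1_lip2 _) x.
    exact: lip2_bound (field2_lip2 _) x.
  exact: lip2_lip (lip2_add (field1_lip2 w') (field2_lip2 A')) x x'.
have -> : field1 w x = field1 (w - w') x + field1 w' x
  by rewrite -field1D subrK.
have -> : field2 A x = field2 (A - A') x + field2 A' x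
  by rewrite -field2D subrK.
abel.
Qed.
End DrivenField.

(** * Almost flows driven by a rough path *)

Lemma powR_mulnr (R : realType) (b x : R) (k : nat) :
  x `^ (k%:R * b) = (x `^ b) ^+ k.
Proof. by rewrite mulrC powRrM powR_mulrn// powR_ge0. Qed.

Lemma norm_tensor (R : realType) (n : nat) (v w : 'cV[R]_n) :
  `|v *m w^T| <= `|v| * `|w|.
Proof.
apply: (le_trans (mulmx_norm _ _)); rewrite mul1r ler_wpM2l//.
apply: mx_norm_ler => // i j; rewrite mxE; exact: ler_mx_norm.
Qed.

Lemma incrD (R : realType) (V : zmodType) (Z : R -> V) (s u t : R) :
  incr Z s t = incr Z s u + incr Z u t.
Proof. by rewrite /incr; abel. Qed.

Section RoughFlow.
Variables (R : realType) (d n : nat) (F : 'cV[R]_d -> 'M[R]_(d, n)) (C : R).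
Hypothesis C0 : 0 <= C.
Hypothesis dF : forall x, differentiable F x.
Hypothesis F_lip2 : lip2 C F.
Hypothesis dF_lip2 : forall v, lip2 (C * `|v|) (fun x => 'd F x v).
Variables (T beta K : R) (W : R -> 'cV[R]_n) (WW : R -> R -> 'M[R]_n).
Hypotheses (T0 : 0 < T) (beta0 : 0 < beta) (K0 : 0 <= K).
Hypothesis chen : forall s u t : R, 0 <= s -> s <= T -> 0 <= u -> u <= T ->
  0 <= t -> t <= T ->
  WW s t = WW s u + WW u t + incr W s u *m (incr W u t)^T.
Hypothesis W_bound : forall s t : R, 0 <= s -> s <= T -> 0 <= t -> t <= T ->
  `|incr W s t| <= K * `|t - s| `^ beta.
Hypothesis WW_bound : forall s t : R, 0 <= s -> s <= T -> 0 <= t -> t <= T ->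
  `|WW s t| <= K * (`|t - s| `^ beta) ^+ 2.

Local Notation c1 := (field1_const n C).
Local Notation c2 := (field2_const n C).
Local Notation L := (T `^ beta).
Let c1_ge0 := field1_const_ge0 n C0.
Let c2_ge0 := field2_const_ge0 n C0.
Let L0 : 0 <= L. Proof. exact: powR_ge0. Qed.

Definition davie_step (s t : R) (x : 'cV[R]_d) : 'cV[R]_d :=
  davie_incr F (incr W s t) (WW s t) x.

Lemma dist_powR_le (s t : R) : 0 <= s -> s <= T -> 0 <= t -> t <= T ->
  `|t - s| `^ beta <= L.
Proof.
move=> s0 sT t0 tT; apply: ge0_ler_powR; rewrite ?nnegrE ?(ltW T0)//.
  exact: ltW.
by rewrite ler_distl; apply/andP; split; lra.
Qed.

Lemma incr_time_diff (s t s' t' : R) : 0 <= s -> s <= T -> 0 <= t -> t <= T ->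
  0 <= s' -> s' <= T -> 0 <= t' -> t' <= T ->
  `|incr W s t - incr W s' t'| <= K * (`|s - s'| `^ beta + `|t - t'| `^ beta).
Proof.
move=> s0 sT t0 tT s'0 s'T t'0 t'T.
rewrite (_ : _ - _ = incr W t' t - incr W s' s); last by rewrite /incr; abel.
rewrite [X in K * X]addrC mulrDr; apply: le_trans (ler_normB _ _) _.
by apply: lerD; apply: W_bound.
Qed.

(** Chen's relation at (s, t', t) and at (s, s', t') moves one end at a time. *)
Lemma rough_time_diff (s t s' t' : R) : 0 <= s -> s <= T -> 0 <= t -> t <= T ->
  0 <= s' -> s' <= T -> 0 <= t' -> t' <= T ->
  `|WW s t - WW s' t'| <=
    (K * L + K * L * K) * (`|s - s'| `^ beta + `|t - t'| `^ beta).
Proof.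
move=> s0 sT t0 tT s'0 s'T t'0 t'T.
have sq (a b : R) : 0 <= a -> a <= T -> 0 <= b -> b <= T ->
    `|WW a b| <= K * L * `|a - b| `^ beta.
  move=> a0 aT b0 bT; apply: (le_trans (WW_bound a0 aT b0 bT)).
  rewrite -(mulrA K L); apply: ler_wpM2l => //.
  rewrite expr2 distrC; apply: ler_wpM2r; first exact: powR_ge0.
  exact: dist_powR_le.
have WL (a b : R) : 0 <= a -> a <= T -> 0 <= b -> b <= T ->
    `|incr W a b| <= K * L.
  move=> a0 aT b0 bT; apply: (le_trans (W_bound a0 aT b0 bT)).
  by apply: ler_wpM2l => //; exact: dist_powR_le.
have tens1 : `|incr W s s' *m (incr W s' t')^T|
  <= K * L * K * `|s - s'| `^ beta.
  apply: (le_trans (norm_tensor _ _)); rewrite mulrC -(mulrA (K * L)).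
  by apply: ler_pM => //; [exact: WL|rewrite distrC; exact: W_bound].
have tens2 : `|incr W s t' *m (incr W t' t)^T| <= K * L * K * `|t - t'| `^ beta.
  apply: (le_trans (norm_tensor _ _)); rewrite -(mulrA (K * L)).
  by apply: ler_pM => //; [exact: WL|exact: W_bound].
have := chen s0 sT t'0 t'T t0 tT; rewrite (chen s0 sT s'0 s'T t'0 t'T) => ->.
rewrite (_ : _ - _ = (WW s s' + incr W s s' *m (incr W s' t')^T) +
  (WW t' t + incr W s t' *m (incr W t' t)^T)); last by abel.
rewrite mulrDr !mulrDl; apply: le_trans (ler_normD _ _) _; apply: lerD.
  apply: le_trans (ler_normD _ _) _; apply: lerD => //; exact: sq.
apply: le_trans (ler_normD _ _) _; apply: lerD => //; rewrite distrC; exact: sq.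
Qed.

Lemma davie_step_time : exists2 M : R, 0 <= M & forall (s t s' t' : R) x x',
  0 <= s -> s <= T -> 0 <= t -> t <= T ->
  0 <= s' -> s' <= T -> 0 <= t' -> t' <= T ->
  `|davie_step s t x - davie_step s' t' x'| <=
    M * (`|s - s'| `^ beta + `|t - t'| `^ beta) + M * `|x - x'|.
Proof.
pose M1 := c1 * K + c2 * (K * L + K * L * K).
pose M2 := c1 * (K * L) + c2 * (K * L ^+ 2).
have KL0 : 0 <= K * L by exact: mulr_ge0.
have M10 : 0 <= M1 by rewrite addr_ge0// mulr_ge0// addr_ge0// mulr_ge0.
have M20 : 0 <= M2 by rewrite addr_ge0// mulr_ge0// mulr_ge0// exprn_ge0.
exists (M1 + M2); first exact: addr_ge0.
move=> s t s' t' x x' s0 sT t0 tT s'0 s'T t'0 t'T.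
apply: (le_trans (davie_incr_diff C0 F_lip2 dF_lip2 _ _ _ _ _ _)).
have e0 : 0 <= `|s - s'| `^ beta + `|t - t'| `^ beta
  by rewrite addr_ge0 ?powR_ge0.
apply: lerD.
  apply: (@le_trans _ _ (M1 * (`|s - s'| `^ beta + `|t - t'| `^ beta)));
    last first.
    by apply: ler_wpM2r => //; rewrite lerDl.
  rewrite mulrDl -(mulrA c1) -(mulrA c2); apply: lerD; apply: ler_wpM2l => //.
    exact: incr_time_diff.
  exact: rough_time_diff.
apply: (@le_trans _ _ (M2 * `|x - x'|)); last first.
  by apply: ler_wpM2r => //; rewrite lerDr.
apply: ler_wpM2r => //; apply: lerD; apply: ler_wpM2l => //.
  apply: (le_trans (W_bound s'0 s'T t'0 t'T)); apply: ler_wpM2l => //.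
  exact: dist_powR_le.
apply: (le_trans (WW_bound s'0 s'T t'0 t'T)); apply: ler_wpM2l => //.
by rewrite lerXn2r ?nnegrE ?powR_ge0//; exact: dist_powR_le.
Qed.

Lemma subinterval_bounds (s u t : R) : 0 <= s -> s <= u -> u <= t -> t <= T ->
  let h := (t - s) `^ beta in
  [/\ 0 <= h <= L, `|incr W s u| <= K * h /\ `|incr W u t| <= K * h
    & `|WW s u| <= K * h ^+ 2 /\ `|WW u t| <= K * h ^+ 2].
Proof.
move=> s0 su ut tT /=; have st := le_trans su ut.
have sT := le_trans st tT; have t0 := le_trans s0 st.
have uT := le_trans ut tT; have u0 := le_trans s0 su.
have pow (a b : R) : 0 <= b - a <= t - s -> `|b - a| `^ beta <= (t - s) `^ beta.
  move=> /andP[ab abh]; rewrite ger0_norm//.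
  by apply: ge0_ler_powR; rewrite ?nnegrE ?(ltW beta0) ?(le_trans ab).
have su_ : `|u - s| `^ beta <= (t - s) `^ beta.
  by apply: pow; rewrite subr_ge0 su lerD2r.
have ut_ : `|t - u| `^ beta <= (t - s) `^ beta.
  by apply: pow; rewrite subr_ge0 ut lerD2l lerN2.
split; first 1 last.
- split; [apply: (le_trans (W_bound s0 sT u0 uT))|
    apply: (le_trans (W_bound u0 uT t0 tT))];
  exact: ler_wpM2l.
- split; [apply: (le_trans (WW_bound s0 sT u0 uT))|
    apply: (le_trans (WW_bound u0 uT t0 tT))];
  by apply: ler_wpM2l => //; rewrite lerXn2r ?nnegrE ?powR_ge0.
- rewrite powR_ge0/=; have := dist_powR_le s0 sT t0 tT.
  by rewrite ger0_norm// subr_ge0.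
Qed.

Lemma davie_almost_flow : exists2 M : R, 0 <= M &
  almost_flow T beta (3%:R * beta) M (fun s t x => x + davie_step s t x).
Proof.
have [Mt Mt0 time] := davie_step_time.
have [Md Md0 defect] := davie_incr_defect_bound C0 dF F_lip2 dF_lip2 K0 L0.
pose D := c1 * K + c2 * K * L.
have D0 : 0 <= D by rewrite addr_ge0// mulr_ge0// mulr_ge0.
have M0 : 0 <= D + Md + Mt by rewrite addr_ge0// addr_ge0.
have defect_lip1 (s u t : R) : 0 <= s -> s <= u -> u <= t -> t <= T ->
    lip1 (Md * (t - s) `^ (3%:R * beta)) (fun x => x + davie_step s u x
      + davie_step u t (x + davie_step s u x) - (x + davie_step s t x)).
  move=> s0 su ut tT; have [/andP[h0 hL] [w1 w2] [A1 A2]] :=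
    subinterval_bounds s0 su ut tT.
  have sT := le_trans (le_trans su ut) tT; have t0 :=
    le_trans s0 (le_trans su ut).
  have uT := le_trans ut tT; have u0 := le_trans s0 su.
  have := defect _ _ _ _ _ h0 hL w1 w2 A1 A2.
  by rewrite powR_mulnr -incrD -(chen s0 sT u0 uT t0 tT).
exists (D + Md + Mt) => //; split.
- move=> s t s0 st tT.
  have [/andP[h0 hL] [w1 _] [A1 _]] := subinterval_bounds s0 st (lexx t) tT.
  have := davie_incr_lip2 C0 F_lip2 dF_lip2 K0 h0 hL w1 A1.
  rewrite (_ : (fun x => x + _ - x) = davie_incr F (incr W s t) (WW s t)).
    by apply: lip2_le; apply: ler_wpM2r => //; rewrite -addrA lerDl addr_ge0.
  by apply/funext => x; rewrite /davie_step; abel.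
- move=> s u t s0 su ut tT; apply: lip1_le (defect_lip1 _ _ _ s0 su ut tT).
  by apply: ler_wpM2r; [exact: powR_ge0|rewrite addrAC lerDr addr_ge0].
- move=> s t s' t' x s0 st tT s'0 st' t'T.
  rewrite (_ : _ - _ = davie_step s t x - davie_step s' t' x); last by abel.
  have := time s t s' t' x x; rewrite subrr normr0 mulr0 addr0 => H.
  apply: (le_trans (H _ _ _ _ _ _ _ _)) => //.
  + exact: le_trans tT.
  + exact: le_trans st.
  + exact: le_trans t'T.
  + exact: le_trans st'.
  + apply: ler_wpM2r; first by rewrite addr_ge0 ?powR_ge0.
    by rewrite lerDr addr_ge0.
Qed.

(** The translations by F(y_s) W_{s,t} + F'(y_s)F(y_s) WW_{s,t} form an almost
    flow: the composition defect does not depend on x and is the failure of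
    additivity bounded in [davie_incr_controlled].  Its trajectories are,
    up to their starting points, the rough integrals of F(y). *)
Lemma controlled_almost_flow (B : R) (y : R -> 'cV[R]_d) :
  (forall s t : R, 0 <= s -> s <= T -> 0 <= t -> t <= T ->
     `|y t - y s| <= B * `|t - s| `^ beta) ->
  (forall s t : R, 0 <= s -> s <= t -> t <= T ->
     `|y t - y s - field1 F (incr W s t) (y s)|
       <= B * ((t - s) `^ beta) ^+ 2) ->
  exists2 M : R, 0 <= M &
    almost_flow T beta (3%:R * beta) M (fun s t x => x + davie_step s t (y s)).
Proof.
move=> yB rB.
have B0 : 0 <= B.
  have := yB 0 T (lexx 0) (ltW T0) (ltW T0) (lexx T).
  rewrite subr0 (ger0_norm (ltW T0)) => h.
  by rewrite -(pmulr_lge0 _ (powR_gt0 beta T0)) (le_trans _ h).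
have [Mt Mt0 time] := davie_step_time.
pose D := c1 * K + c2 * K * L.
pose Md := c1 * K * B ^+ 2 + c1 * K * B + c2 * K * B.
have D0 : 0 <= D by rewrite addr_ge0// mulr_ge0// mulr_ge0.
have Md0 : 0 <= Md by rewrite !addr_ge0// !mulr_ge0// exprn_ge0.
pose Ms := Mt + Mt * B.
have Ms0 : 0 <= Ms by rewrite addr_ge0// mulr_ge0.
have M0 : 0 <= D + Md + Ms by rewrite addr_ge0// addr_ge0.
exists (D + Md + Ms) => //; split.
- move=> s t s0 st tT.
  have [/andP[h0 hL] [w1 _] [A1 _]] := subinterval_bounds s0 st (lexx t) tT.
  have := davie_incr_lip2 C0 F_lip2 dF_lip2 K0 h0 hL w1 A1 => l.
  rewrite (_ : (fun x => x + _ - x) = fun=> davie_step s t (y s)).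
    apply: lip2_le (lip2_cst _ _); apply: (le_trans (lip2_bound l (y s))).
    by apply: ler_wpM2r => //; rewrite -addrA lerDl addr_ge0.
  by apply/funext => x; abel.
- move=> s u t s0 su ut tT.
  have [/andP[h0 hL] [_ w2] [_ A2]] := subinterval_bounds s0 su ut tT.
  have sT := le_trans (le_trans su ut) tT; have t0 :=
    le_trans s0 (le_trans su ut).
  have uT := le_trans ut tT; have u0 := le_trans s0 su.
  have us : `|u - s| `^ beta <= (t - s) `^ beta.
    rewrite ger0_norm ?subr_ge0//; apply: ge0_ler_powR;
      rewrite ?nnegrE ?subr_ge0//.
    - exact: ltW.
    - exact: le_trans ut.
    - by rewrite lerD2r.
  have yu : `|y u - y s| <= B * (t - s) `^ beta.
    by apply: (le_trans (yB _ _ s0 sT u0 uT)); exact: ler_wpM2l.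
  have ru : `|y u - y s - field1 F (incr W s u) (y s)|
    <= B * ((t - s) `^ beta) ^+ 2.
    apply: (le_trans (rB _ _ s0 su uT)); apply: ler_wpM2l => //.
    rewrite ger0_norm ?subr_ge0// in us.
    by rewrite lerXn2r ?nnegrE ?powR_ge0.
  have := davie_incr_controlled C0 dF F_lip2 dF_lip2 (WW s u) K0 B0 h0
    w2 A2 yu ru.
  rewrite -incrD -(chen s0 sT u0 uT t0 tT) => H.
  split=> [x|x z]; last first.
    rewrite (_ : _ - _ = 0); last by abel.
    by rewrite normr0 mulr_ge0// mulr_ge0// powR_ge0.
  rewrite [X in `|X|](_ : _ = davie_step s u (y s) + davie_step u t (y u) -
    davie_step s t (y s)); last by abel.
  rewrite powR_mulnr; apply: (le_trans H).
  apply: ler_wpM2r; first exact: exprn_ge0.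
  by rewrite -[leLHS]/Md [leRHS]addrAC lerDr addr_ge0.
- move=> s t s' t' x s0 st tT s'0 st' t'T.
  have sT := le_trans st tT; have t0 := le_trans s0 st.
  have s'T := le_trans st' t'T; have t'0 := le_trans s'0 st'.
  rewrite (_ : _ - _ = davie_step s t (y s) - davie_step s' t' (y s'));
    last by abel.
  apply: (le_trans (time _ _ _ _ _ _ s0 sT t0 tT s'0 s'T t'0 t'T)).
  have e0 : 0 <= `|s - s'| `^ beta + `|t - t'| `^ beta
    by rewrite addr_ge0 ?powR_ge0.
  apply: (@le_trans _ _ (Ms * (`|s - s'| `^ beta + `|t - t'| `^ beta)));
    last first.
    by apply: ler_wpM2r => //; rewrite lerDr addr_ge0.
  rewrite /Ms mulrDl lerD2l -mulrA; apply: ler_wpM2l => //.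
  apply: (le_trans (yB _ _ s'0 s'T s0 sT)); apply: ler_wpM2l => //.
  by rewrite lerDl powR_ge0.
Qed.

Lemma increment_of_remainder (B : R) (y : R -> 'cV[R]_d) :
  (forall s t : R, 0 <= s -> s <= T -> 0 <= t -> t <= T ->
     `|y t - y s - field1 F (incr W s t) (y s)|
       <= B * (`|t - s| `^ beta) ^+ 2) ->
  forall s t : R, 0 <= s -> s <= T -> 0 <= t -> t <= T ->
    `|y t - y s| <= (`|B| * L + c1 * K) * `|t - s| `^ beta.
Proof.
move=> rB s t s0 sT t0 tT.
rewrite (_ : y t - y s = (y t - y s - field1 F (incr W s t) (y s)) +
  field1 F (incr W s t) (y s)); last by abel.
rewrite mulrDl; apply: le_trans (ler_normD _ _) _; apply: lerD.
  apply: (le_trans (rB _ _ s0 sT t0 tT)); rewrite expr2 mulrA.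
  apply: ler_wpM2r; first exact: powR_ge0.
  apply: (@le_trans _ _ (`|B| * `|t - s| `^ beta)).
    by apply: ler_wpM2r; [exact: powR_ge0|exact: ler_norm].
  by apply: ler_wpM2l => //; exact: dist_powR_le.
apply: (le_trans (lip2_bound (field1_lip2 F_lip2 _) _)).
by rewrite -(mulrA c1); apply: ler_wpM2l => //; exact: W_bound.
Qed.

(** For s <= t this drops the second-level term from the local expansion.  For
    t < s the roles are exchanged, at the price of (F(y_s) - F(y_t)) W_{t,s}, a
    product of two terms of order beta. *)
Lemma trajectory_remainder (y : R -> 'cV[R]_d) :
  trajectory T (3%:R * beta) (fun s t x => x + davie_step s t x) y ->
  exists2 B : R, 0 <= B & forall s t : R, 0 <= s -> s <= T -> 0 <= t ->
    t <= T ->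
    `|y t - y s - field1 F (incr W s t) (y s)| <= B * (`|t - s| `^ beta) ^+ 2.
Proof.
move=> [Ct yC].
(* R2 and R1 are the constants of the remainder and of the increment for
   s <= t. *)
pose R2 := `|Ct| * L + c2 * K.
have R20 : 0 <= R2 by rewrite addr_ge0// mulr_ge0.
have fwd (s t : R) : 0 <= s -> s <= t -> t <= T ->
    `|y t - y s - field1 F (incr W s t) (y s)| <= R2 * ((t - s) `^ beta) ^+ 2.
  move=> s0 st tT; have sT := le_trans st tT; have t0 := le_trans s0 st.
  have := yC _ _ s0 st tT; rewrite powR_mulnr => yst.
  have hL := dist_powR_le s0 sT t0 tT; rewrite ger0_norm ?subr_ge0// in hL.
  rewrite (_ : _ - _ = (y t - (y s + davie_step s t (y s))) +
    field2 F (WW s t) (y s)); last by rewrite /davie_step /davie_incr; abel.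
  rewrite mulrDl; apply: le_trans (ler_normD _ _) _; apply: lerD.
    apply: (le_trans yst); rewrite exprS mulrA.
    apply: ler_wpM2r; first by rewrite exprn_ge0 ?powR_ge0.
    apply: (le_trans (ler_norm _)); rewrite normrM [`|_ `^ _|]ger0_norm
      ?powR_ge0//.
    exact: ler_wpM2l.
  apply: (le_trans (lip2_bound (field2_lip2 C0 F_lip2 dF_lip2 _) _)).
  rewrite -(mulrA c2); apply: ler_wpM2l => //.
  by have := WW_bound s0 sT t0 tT; rewrite ger0_norm ?subr_ge0.
pose R1 := R2 * L + c1 * K.
have R10 : 0 <= R1 by rewrite addr_ge0// mulr_ge0.
have incr_le (s t : R) : 0 <= s -> s <= t -> t <= T ->
    `|y t - y s| <= R1 * (t - s) `^ beta.
  move=> s0 st tT; have sT := le_trans st tT; have t0 := le_trans s0 st.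
  have hL := dist_powR_le s0 sT t0 tT; rewrite ger0_norm ?subr_ge0// in hL.
  rewrite (_ : y t - y s = (y t - y s - field1 F (incr W s t) (y s)) +
    field1 F (incr W s t) (y s)); last by abel.
  rewrite mulrDl; apply: le_trans (ler_normD _ _) _; apply: lerD.
    apply: (le_trans (fwd _ _ s0 st tT)); rewrite expr2 mulrA.
    apply: ler_wpM2r; first exact: powR_ge0.
    exact: ler_wpM2l.
  apply: (le_trans (lip2_bound (field1_lip2 F_lip2 _) _)).
  rewrite -(mulrA c1); apply: ler_wpM2l => //.
  by have := W_bound s0 sT t0 tT; rewrite ger0_norm ?subr_ge0.
have R30 : 0 <= c1 * K * R1 by rewrite mulr_ge0// mulr_ge0.
exists (R2 + c1 * K * R1); first exact: addr_ge0.
move=> s t s0 sT t0 tT; have [st|ts] := leP s t.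
  rewrite ger0_norm ?subr_ge0//; apply: (le_trans (fwd _ _ s0 st tT)).
  by apply: ler_wpM2r; [rewrite exprn_ge0 ?powR_ge0|rewrite lerDl].
have {}ts := ltW ts.
have flip x : field1 F (incr W s t) x = - field1 F (incr W t s) x.
  by rewrite /field1 -mulmxN /incr opprB.
rewrite [`|t - s|]distrC ger0_norm ?subr_ge0// flip.
rewrite (_ : _ - _ = - (y s - y t - field1 F (incr W t s) (y t)) +
  (field1 F (incr W t s) (y s) - field1 F (incr W t s) (y t))); last by abel.
rewrite mulrDl; apply: le_trans (ler_normD _ _) _; rewrite normrN; apply: lerD.
  exact: fwd.
apply: (le_trans (lip2_lip (field1_lip2 F_lip2 _) _ _)).
rewrite [leRHS](_ : _ = c1 * (K * (s - t) `^ beta) * (R1 * (s - t) `^ beta));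
  last by ring.
apply: ler_pM => //; first exact: mulr_ge0; last exact: incr_le.
apply: ler_wpM2l => //.
by have := W_bound t0 tT s0 sT; rewrite ger0_norm ?subr_ge0.
Qed.
End RoughFlow.

(** * The fixed point equation *)

(** The bounds on D^j F for j <= 3 give Lipschitz bounds on D^j F for j <= 2 by
    the mean value inequality; these feed [lip2_diff] for F and for F'. *)
Lemma Cb3_lip2 (R : realType) (d n : nat) (F : 'cV[R]_d -> 'M[R]_(d, n)) :
  Cb 3 F -> exists C : R, [/\ 0 <= C, forall x, differentiable F x, lip2 C F
    & forall v, lip2 (C * `|v|) (fun x => 'd F x v)].
Proof.
move=> [Fd _ Fb].
have [C [C0 CF]] : exists C : R, 0 <= C /\ forall vs x, (size vs <= 3)%N ->
    `|iter_diff F vs x| <= C * \prod_(v <- vs) `|v|.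
  have [B0 H0] := Fb 0%N isT; have [B1 H1] := Fb 1%N isT.
  have [B2 H2] := Fb 2%N isT; have [B3 H3] := Fb 3%N isT.
  exists (`|B0| + `|B1| + `|B2| + `|B3|); split; first by rewrite !addr_ge0.
  move=> vs x; have p0 : 0 <= \prod_(v <- vs) `|v| by rewrite prodr_ge0.
  have le B : `|iter_diff F vs x| <= B * \prod_(v <- vs) `|v| ->
      `|B| <= `|B0| + `|B1| + `|B2| + `|B3| ->
      `|iter_diff F vs x| <=
        (`|B0| + `|B1| + `|B2| + `|B3|) * \prod_(v <- vs) `|v|.
    move=> H BB; apply: (le_trans H); apply: ler_wpM2r => //.
    exact: le_trans (ler_norm _) BB.
  case E : (size vs) => [|[|[|[|k]]]] // _.
  - by apply: (le B0 (H0 _ _ E)); rewrite -!addrA lerDl !addr_ge0.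
  - apply: (le B1 (H1 _ _ E)).
    by rewrite [`|B0| + _]addrC -!addrA lerDl !addr_ge0.
  - by apply: (le B2 (H2 _ _ E)); rewrite -addrA addrCA lerDl !addr_ge0.
  - by apply: (le B3 (H3 _ _ E)); rewrite lerDr !addr_ge0.
have d0 x : differentiable F x by exact: (Fd [::] isT x).
have d1 v x : differentiable (fun y => 'd F y v) x by exact: (Fd [:: v] isT x).
have d2 a v x : differentiable (iter_diff F [:: a; v]) x by exact: (Fd [:: a;
  v] isT x).
have b0 x : `|F x| <= C by have := CF [::] x isT; rewrite big_nil mulr1.
have b1 v x : `|'d F x v| <= C * `|v|.
  by have := CF [:: v] x isT; rewrite big_seq1.
have b2 a v x : `|'d (fun y => 'd F y v) x a| <= C * `|v| * `|a|.
  by have := CF [:: a; v] x isT; rewrite big_cons big_seq1 [_ * `|v|]mulrC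
    mulrA.
have b3 b a v x : `|'d (iter_diff F [:: a; v]) x b| <= C * `|v| * `|a| * `|b|.
  have := CF [:: b; a; v] x isT; rewrite !big_cons big_nil mulr1.
  by rewrite [`|b| * _]mulrC [`|a| * _]mulrC !mulrA.
exists C; split=> //.
- apply: lip2_diff => // x y v.
  exact: (lipschitz_diff (d1 v) (fun x a => b2 a v x)).
- move=> v; apply: lip2_diff => // x y a.
  exact: (lipschitz_diff (d2 a v) (fun x b => b3 b a v x)).
Qed.

Lemma in_0T (R : realType) (T t : R) : (t \in `[0, T]) = (0 <= t <= T).
Proof. by rewrite in_itv. Qed.

Lemma rough_path_bounds (R : realType) (n : nat) (beta T : R)
    (W : R -> 'cV[R]_n) (WW : R -> R -> 'M[R]_n) :
  0 < beta -> rough_path beta T W WW ->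
  [/\ forall s u t : R, 0 <= s -> s <= T -> 0 <= u -> u <= T -> 0 <= t ->
    t <= T ->
        WW s t = WW s u + WW u t + incr W s u *m (incr W u t)^T
    & exists K : R, [/\ 0 <= K,
        forall s t : R, 0 <= s -> s <= T -> 0 <= t -> t <= T ->
          `|incr W s t| <= K * `|t - s| `^ beta
      & forall s t : R, 0 <= s -> s <= T -> 0 <= t -> t <= T ->
          `|WW s t| <= K * (`|t - s| `^ beta) ^+ 2]].
Proof.
move=> b0 [ch [C1 H1] [C2 H2]].
have chen (s u t : R) : 0 <= s -> s <= T -> 0 <= u -> u <= T -> 0 <= t ->
  t <= T ->
    WW s t = WW s u + WW u t + incr W s u *m (incr W u t)^T.
  move=> s0 sT u0 uT t0 tT; rewrite -(ch s u t) ?in_0T ?s0 ?u0 ?t0//; abel.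
split=> //.
exists (`|C1| + `|C2|); split; first exact: addr_ge0.
- move=> s t s0 sT t0 tT; have [->|st] := eqVneq s t.
    by rewrite /incr subrr normr0 mulr_ge0 ?addr_ge0 ?powR_ge0.
  have p0 : 0 < `|t - s| `^ beta by rewrite powR_gt0// normr_gt0 subr_eq0
    eq_sym.
  have := H1 s t; rewrite !in_0T s0 sT t0 tT => /(_ isT isT st).
  rewrite ler_pdivrMr// => /le_trans; apply; apply: ler_wpM2r; first exact: ltW.
  by apply: (le_trans (ler_norm _)); rewrite lerDl.
- move=> s t s0 sT t0 tT; have [->|st] := eqVneq s t.
    (* Chen's relation at (t, t, t) reads WW_{t,t} = 2 WW_{t,t}. *)
    have := chen t t t t0 tT t0 tT t0 tT.
    rewrite /incr subrr mul0mx addr0 -{1}[WW t t]addr0 => /addrI <-.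
    by rewrite normr0 mulr_ge0 ?addr_ge0// exprn_ge0// powR_ge0.
  have p0 : 0 < (`|t - s| `^ beta) ^+ 2.
    by rewrite exprn_gt0// powR_gt0// normr_gt0 subr_eq0 eq_sym.
  have := H2 s t; rewrite !in_0T s0 sT t0 tT => /(_ isT isT st).
  rewrite powR_mulnr ler_pdivrMr// => /le_trans; apply.
  apply: ler_wpM2r; first exact: ltW.
  by apply: (le_trans (ler_norm _)); rewrite lerDr.
Qed.

Lemma opnorm_le (R : realType) (n p q : nat) (b : 'Hom('cV[R]_n, 'M[R]_(p, q)))
    (c : R) : 0 <= c -> (forall v, `|b v| <= c * `|v|) -> opnorm b <= c.
Proof.
move=> c0 bc; apply: ge_sup; first by exists `|b 0|; exists 0 => //=;
  rewrite normr0.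
move=> _ [v /= v1 <-]; apply: (le_trans (bc v)).
by rewrite -[leRHS]mulr1 ler_wpM2l.
Qed.

Lemma opnorm_mulmxB (R : realType) (d n : nat) (A B : 'M[R]_(d, n)) :
  opnorm (linfun (mulmx A) - linfun (mulmx B) : 'Hom('cV[R]_n, 'cV[R]_d))
    <= n%:R * `|A - B|.
Proof.
apply: opnorm_le => [|v]; first exact: mulr_ge0.
rewrite add_lfunE opp_lfunE !lfunE -mulmxBl; exact: mulmx_norm.
Qed.

(** A path whose increments are the Davie increments along Y up to order
    theta > 1 computes the rough integral, so the limit over subdivisions need
    never be constructed. *)
Lemma rough_integral_davie (R : realType) (d n : nat) (T theta : R)
    (F : 'cV[R]_d -> 'M[R]_(d, n)) (W : R -> 'cV[R]_n) (WW : R -> R -> 'M[R]_n)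
    (Y : R -> expr R n d 1) (y : R -> 'cV[R]_d) :
  1 < theta ->
  (forall s : R, 0 <= s -> s <= T -> (Y s).2 = linfun (mulmx (F (Y s).1))) ->
  (exists C : R, forall s t : R, 0 <= s -> s <= t -> t <= T ->
     `|y t - (y s + davie_step F W WW s t (Y s).1)| <= C * (t - s) `^ theta) ->
  forall t : R, 0 <= t -> t <= T ->
  rough_integral W WW (Fhat F Y) t = y t - y 0.
Proof.
move=> th1 Y2 [C yC]; apply: (@rough_integralE _ _ _ _ _ C) th1 _ =>
  s t s0 st tT.
have yst := yC _ _ s0 st tT; apply: le_trans yst.
rewrite (_ : y t - (_ + davie_step F W WW s t (Y s).1) =
  y t - y s - davie_step F W WW s t (Y s).1); last by abel.
by rewrite /davie_step /davie_incr /field1 /field2 /Fhat /= Y2// (le_trans st).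
Qed.

Theorem theorem10p1 (R : realType) (d n : nat) (T beta : R) (xi : 'cV[R]_d)
    (F : 'cV[R]_d -> 'M[R]_(d, n))
    (W : R -> 'cV[R]_n) (WW : R -> R -> 'M[R]_n) :
  0 < T -> 1 / 3 < beta -> beta < 1 / 2 ->
  Cb 3 F -> rough_path beta T W WW ->
  exists Y : R -> expr R n d 1,
    [/\ modelled beta T W Y,
        forall t : R, t \in `[0, T] ->
          Y t = (xi, 0) + integration_map W WW (Fhat F Y) t
      & forall Y' : R -> expr R n d 1,
          modelled beta T W Y' ->
          (forall t : R, t \in `[0, T] ->
             Y' t = (xi, 0) + integration_map W WW (Fhat F Y') t) ->
          forall t : R, t \in `[0, T] -> Y' t = Y t].
Proof.
move=> T0 beta3 _ FC3 roughW.
have beta0 : 0 < beta by apply: lt_trans beta3; rewrite divr_gt0.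
have theta1 : 1 < 3%:R * beta by rewrite mulrC -ltr_pdivrMr.
have [C [C0 dF F_lip2 dF_lip2]] := Cb3_lip2 FC3.
have [chen [K [K0 W_bound WW_bound]]] := rough_path_bounds beta0 roughW.
have [M M0 flow] :=
  davie_almost_flow C0 dF F_lip2 dF_lip2 T0 beta0 K0 chen W_bound WW_bound.
have [y y0 traj] := trajectory_exists T0 beta0 theta1 M0 flow xi.
pose Y t : expr R n d 1 := (y t, linfun (mulmx (F (y t)))).
exists Y; split.
- have [B B0 remB] := trajectory_remainder C0 F_lip2 dF_lip2 T0 beta0 K0
    W_bound WW_bound traj.
  have incB := increment_of_remainder C0 F_lip2 T0 beta0 W_bound remB.
  pose B1 := `|B| * T `^ beta + field1_const n C * K.
  exists (B + n%:R * (C * `|B1|)) => s t; rewrite !in_0T.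
  move=> /andP[s0 sT] /andP[t0 tT] st.
  have p0 : 0 < `|t - s| by rewrite normr_gt0 subr_eq0 eq_sym.
  have q0 : 0 <= n%:R * (C * `|B1|) by rewrite !mulr_ge0.
  have twob : 2 * beta - beta = beta by ring.
  split; rewrite ?twob.
  + rewrite powR_mulnr ler_pdivrMr ?exprn_gt0 ?powR_gt0//.
    apply: (@le_trans _ _ (B * (`|t - s| `^ beta) ^+ 2)); last first.
      by apply: ler_wpM2r; [rewrite exprn_ge0 ?powR_ge0|rewrite lerDl].
    have := remB s t s0 sT t0 tT.
    by rewrite /expr_norm0 /Gamma /= lfunE opprD addrA.
  + rewrite ler_pdivrMr ?powR_gt0//.
    apply: (@le_trans _ _ (n%:R * (C * `|B1|) * `|t - s| `^ beta)); last first.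
      by apply: ler_wpM2r; [exact: powR_ge0|rewrite lerDr].
    apply: (le_trans (opnorm_mulmxB _ _)).
    rewrite -mulrA -(mulrA C); apply: ler_wpM2l => //.
    apply: (le_trans (lip2_lip F_lip2 _ _)); apply: ler_wpM2l => //.
    apply: (le_trans (incB s t s0 sT t0 tT)).
    by apply: ler_wpM2r; [exact: powR_ge0|exact: ler_norm].
- move=> t; rewrite in_0T => /andP[t0 tT].
  have Y2 (s : R) : 0 <= s -> s <= T -> (Y s).2 = linfun (mulmx (F (Y s).1)).
    by [].
  have int := rough_integral_davie theta1 Y2 traj t0 tT.
  rewrite /integration_map int y0 /Y; congr (_, _) => /=; last by rewrite add0r.
  abel.
move=> Y' [C' modY'] fixY' t; rewrite in_0T => /andP[t0 tT].
pose y' t := (Y' t).1.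
(* The fixed point equation determines the coefficient of the symbol W, so only
   the first component of Y' remains to be compared with y. *)
have Y'2 (r : R) : 0 <= r -> r <= T -> (Y' r).2 = linfun (mulmx (F (y' r))).
  move=> r0 rT; have := fixY' r; rewrite in_0T r0 rT => /(_ isT) e.
  by rewrite [in LHS]e /= add0r.
have Y'1 (r : R) : 0 <= r -> r <= T ->
    y' r = xi + rough_integral W WW (Fhat F Y') r.
  move=> r0 rT; have := fixY' r; rewrite in_0T r0 rT => /(_ isT) e.
  by rewrite /y' [in LHS]e.
have rem' (s r : R) : 0 <= s -> s <= T -> 0 <= r -> r <= T ->
    `|y' r - y' s - field1 F (incr W s r) (y' s)|
      <= C' * (`|r - s| `^ beta) ^+ 2.
  move=> s0 sT r0 rT; have [->|sr] := eqVneq s r.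
    rewrite /field1 /incr !subrr mulmx0 subr0 !normr0 powR0 ?gt_eqF//.
    by rewrite expr0n mulr0.
  have p0 : 0 < `|r - s| by rewrite normr_gt0 subr_eq0 eq_sym.
  have [] := modY' s r _ _ sr; rewrite ?in_0T ?s0 ?r0// => H _; move: H.
  rewrite powR_mulnr ler_pdivrMr ?exprn_gt0 ?powR_gt0//.
  by rewrite /expr_norm0 /Gamma /= Y'2// lfunE opprD addrA.
have inc' := increment_of_remainder C0 F_lip2 T0 beta0 W_bound rem'.
pose B' := `|C'| + (`|C'| * T `^ beta + field1_const n C * K).
have B'0 : 0 <= `|C'| * T `^ beta + field1_const n C * K.
  by rewrite addr_ge0 ?mulr_ge0 ?powR_ge0.
have [M' M'0 flow'] : exists2 M' : R, 0 <= M' &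
    almost_flow T beta (3%:R * beta) M'
    (fun s t x => x + davie_step F W WW s t (y' s)).
  apply: (controlled_almost_flow C0 dF F_lip2 dF_lip2 T0 beta0 K0 chen W_bound
    WW_bound (B := B')) => s r s0 sT.
    move=> r0 rT; apply: (le_trans (inc' s r s0 sT r0 rT)).
    by apply: ler_wpM2r; [exact: powR_ge0|rewrite lerDr].
  move=> rT; have r0 := le_trans s0 sT; have sT' := le_trans sT rT.
  have := rem' s r s0 sT' r0 rT; rewrite ger0_norm ?subr_ge0// => /le_trans;
    apply.
  apply: ler_wpM2r; first by rewrite exprn_ge0 ?powR_ge0.
  by apply: (le_trans (ler_norm _)); rewrite lerDl.
(* I is the rough integral of F(y'), started at xi. *)
have [I I0 trajI] := trajectory_exists T0 beta0 theta1 M'0 flow' xi.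
have y'I (r : R) : 0 <= r -> r <= T -> y' r = I r.
  move=> r0 rT; rewrite Y'1// (rough_integral_davie theta1 Y'2 trajI r0 rT) I0.
  by rewrite addrC subrK.
have traj' : trajectory T (3%:R * beta)
    (fun s t x => x + davie_step F W WW s t x) y'.
  have [CI HI] := trajI; exists CI => s r s0 sr rT.
  have sT := le_trans sr rT; have r0 := le_trans s0 sr.
  by have := HI _ _ s0 sr rT; rewrite -!y'I.
have yy' : y' t = y t.
  apply: (trajectory_unique T0 beta0 theta1 M0 flow traj' traj) => //.
  by rewrite y'I ?(ltW T0)// I0 y0.
by rewrite [LHS]surjective_pairing Y'2// -/(y' t) yy'.
Qed.
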